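(* Let $n,N\ge 1$ be integers. For each $i\in[N]=\{1,\dots,N\}$ let $f_i:\mathbb{R}^n\to\mathbb{R}$ be a locally Lipschitz continuous path-differentiable function admitting $\mathcal{D}_{f_i}:\mathbb{R}^n\rightrightarrows\mathbb{R}^n$ as a conservative field. Put $f=\frac1N\sum_{i=1}^N f_i$ and $\mathcal{D}_f(x)=\mathrm{conv}\big(\frac1N\sum_{i=1}^N\mathcal{D}_{f_i}(x)\big)$. Assume that the set $\{f(x): 0\in\mathcal{D}_f(x)\}$ has empty interior in $\mathbb{R}$ and that $f$ is bounded from below on $\mathbb{R}^n$. Let $\beta\in[0,1)$ and $\varepsilon_0>0$, and let $\{x_k\},\{m_k\},\{g_k\}\subset\mathbb{R}^n$, $\{\eta_k\},\{\mu_k\},\{\tau_k\}\subset\mathbb{R}$, $\{i_k\}\subset[N]$ (all indexed by $k\ge 0$) satisfy, for all $k\ge0$, $$\eta_k=\frac{\mu_k}{\sqrt{\varepsilon_0+\sum_{i=1}^k\tau_i\|m_i\|^2}},\qquad m_{k+1}=\beta m_k+(1-\beta)g_k,\qquad x_{k+1}=x_k-\eta_k m_{k+1}.$$ Assume: (1) for every $j\ge0$, $\{i_k: jN\le k<(j+1)N\}=[N]$; (2) $\{x_k\}$ is bounded; (3) $\{\tau_k\}$ and $\{\mu_k\}$ are positive and non-decreasing, and there is a locally bounded function $\psi:\mathbb{R}^n\to[0,\infty)$ with $\max\{\tau_k,\mu_k\}\le\sup_{0\le i\le k}\psi(x_i)$ for all $k\ge0$; (4) there is a diminishing sequence $\{\delta_k\}$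 such that $g_k\in\mathcal{D}_{f_{i_k}}^{\delta_k}(x_k)$ for all $k\ge0$. Then any cluster point of $\{x_k\}$ lies in $\{x\in\mathbb{R}^n: 0\in\mathcal{D}_f(x)\}$, and the sequence $\{f(x_k)\}$ converges.
   Context: $\|\cdot\|$ is the Euclidean norm on $\mathbb{R}^n$, $\mathrm{conv}$ the convex hull; sums of sets are Minkowski sums; $\mathrm{dist}(w,Y)=\inf_{y\in Y}\|w-y\|$; $\mathbb{B}_\delta(x)=\{z:\|z-x\|\le\delta\}$. ''Diminishing'' means nonnegative and converging to $0$. A set-valued mapping $\mathcal{D}:\mathbb{R}^n\rightrightarrows\mathbb{R}^n$ assigns to each $x$ a subset $\mathcal{D}(x)\subseteq\mathbb{R}^n$. It is graph-closed if $\{(x,d):d\in\mathcal{D}(x)\}$ is closed, and locally bounded if $\sup_{x\in K,\,d\in\mathcal{D}(x)}\|d\|<\infty$ for every compact $K$. For $\delta\ge0$ its $\delta$-expansion is $\mathcal{D}^\delta(x)=\{w\in\mathbb{R}^n:\exists z\in\mathbb{B}_\delta(x),\ \mathrm{dist}(w,\mathcal{D}(z))\le\delta\}$. A real function is locally bounded if it is bounded on compact sets. Conservative field: let $h:\mathbb{R}^n\to\mathbb{R}$ be locally Lipschitz and $\mathcal{D}:\mathbb{R}^n\rightrightarrows\mathbb{R}^n$ graph-closed and locally bounded. $\mathcal{D}$ is a conservative field for $h$ (and $h$ is a potential function for $\mathcal{D}$) if for every $x\in\mathbb{R}^n$ and every absolutely continuous curve $\gamma$ with $\gamma(0)=0$,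 $\gamma(1)=x$, one has $h(x)=h(0)+\int_0^1\sup_{l\in\mathcal{D}(\gamma(s))}\langle l,\dot\gamma(s)\rangle\,ds$ (with $\sup\emptyset=-\infty$, so that the values of $\mathcal{D}$ are necessarily nonempty). $h$ is path-differentiable if it is a potential function for some conservative field. *)

(* Defs.v *)
From HB Require Import structures.
From mathcomp Require Import all_boot all_order all_algebra.
From mathcomp Require Import all_classical all_reals all_analysis.

Set Implicit Arguments.
Unset Strict Implicit.
Unset Printing Implicit Defensive.

Import Order.TTheory GRing.Theory Num.Theory.
Import numFieldNormedType.Exports.

Local Open Scope classical_set_scope.
Local Open Scope ring_scope.

(* MathComp-Analysis equips 'rV[R]_n with the max norm.  Only equivalence-invariant
   notions (closed, compact, cluster, convergence, derivative, local Lipschitz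
   continuity) are taken from it; wherever a norm is written it is the Euclidean
   norm [enorm]. *)

Definition dotv (R : realType) (n : nat) (u v : 'rV[R]_n) : R :=
  \sum_(i < n) u 0 i * v 0 i.

Definition enorm (R : realType) (n : nat) (u : 'rV[R]_n) : R :=
  Num.sqrt (dotv u u).

(* Extended-real valued, so that the distance to the empty set is +oo. *)
Definition edistv (R : realType) (n : nat) (w : 'rV[R]_n) (Y : set 'rV[R]_n) :
  \bar R := ereal_inf [set (enorm (w - y))%:E | y in Y].

Definition convex_hull (R : realType) (n : nat) (A : set 'rV[R]_n) :
  set 'rV[R]_n :=
  smallest (fun C : set (convex_lmodType 'rV[R]_n) => convex_set C) A.

Definition setmap (R : realType) (n : nat) := 'rV[R]_n -> set 'rV[R]_n.

Definition graph_closed (R : realType) (n : nat) (D : setmap R n) : Prop :=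
  closed [set xd : 'rV[R]_n * 'rV[R]_n | D xd.1 xd.2].

Definition locally_bounded_map (R : realType) (n : nat) (D : setmap R n) : Prop :=
  forall K : set 'rV[R]_n, compact K ->
  exists M : R, forall x d, K x -> D x d -> enorm d <= M.

Definition locally_bounded_fun (R : realType) (n : nat) (f : 'rV[R]_n -> R) :
  Prop :=
  forall K : set 'rV[R]_n, compact K ->
  exists M : R, forall x, K x -> `|f x| <= M.

Definition locally_lipschitz (R : realType) (n : nat) (f : 'rV[R]_n -> R) : Prop :=
  forall x : 'rV[R]_n, exists2 V, nbhs x V & [lipschitz f y | y in V].

Definition expansion (R : realType) (n : nat) (D : setmap R n) (delta : R) :
  setmap R n :=
  fun x => [set w | exists2 z, enorm (z - x) <= delta &
                               (edistv w (D z) <= delta%:E)%E].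

(* Absolute continuity on [0, 1]: finitely many pairwise non-overlapping
   (possibly degenerate) subintervals of small total length have small total
   oscillation. *)
Definition abs_continuous01 (R : realType) (n : nat) (gamma : R -> 'rV[R]_n) :
  Prop :=
  forall e : R, 0 < e -> exists2 d : R, 0 < d &
    forall (m : nat) (a b : 'I_m -> R),
      (forall i, [/\ 0 <= a i, a i <= b i & b i <= 1]) ->
      trivIset [set: 'I_m] (fun i => [set` `]a i, b i[]) ->
      \sum_(i < m) (b i - a i) < d ->
      \sum_(i < m) enorm (gamma (b i) - gamma (a i)) < e.

(* The supremum and the integral are taken in \bar R, so that a curve spending a
   set of times of positive measure where D is empty contributes -oo.  The value
   of [derive1 gamma s] at the null set of times where gamma is not derivable is
   irrelevant. *)
Definition conservative_field (R : realType) (n : nat) (h : 'rV[R]_n -> R)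
    (D : setmap R n) : Prop :=
  [/\ locally_lipschitz h, graph_closed D, locally_bounded_map D &
      forall (x : 'rV[R]_n) (gamma : R -> 'rV[R]_n),
        abs_continuous01 gamma -> gamma 0 = 0 -> gamma 1 = x ->
        ((h x)%:E = (h 0)%:E +
           \int[lebesgue_measure]_(s in `[0%R, 1%R])
             ereal_sup [set (dotv l (derive1 gamma s))%:E | l in D (gamma s)])%E].

Definition path_differentiable (R : realType) (n : nat) (h : 'rV[R]_n -> R) :
  Prop :=
  exists D : setmap R n, conservative_field h D.

Definition mean_fun (R : realType) (n N : nat) (f : 'I_N -> 'rV[R]_n -> R) :
  'rV[R]_n -> R :=
  fun x => N%:R^-1 * \sum_(i < N) f i x.

Definition mean_field (R : realType) (n N : nat) (D : 'I_N -> setmap R n) :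
  setmap R n :=
  fun x => convex_hull
    [set N%:R^-1 *: \sum_(i < N) d i |
      d in [set d : 'I_N -> 'rV[R]_n | forall i, D i x (d i)]].

Definition critical_set (R : realType) (n : nat) (D : setmap R n) :
  set 'rV[R]_n := [set x | D x 0].

(* Main.v *)
(** The denominator of the step size is nondecreasing.  If it stays bounded, then
    m_k -> 0, hence g_k -> 0, and averaging g over one epoch near a cluster point
    shows that point to be critical.  Otherwise eta_k -> 0 with finite total
    variation; the change of variables y_k = x_k - beta / (1 - beta) eta_k m_k,
    sampled once per epoch and corrected by the tail of a summable error, turns
    the method into an exact recursion Z_(j+1) = Z_j - a_j s_j, where s_j is an
    inexact element of the mean field.  Pointwise limits, along an ultrafilter, of
    the time-shifted interpolations of Z are Lipschitz curves c which, run backwards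
    in time, satisfy c' \in D_f(c) wherever they are differentiable.  Since f
    strictly increases along such a curve unless it ends at a critical point, Z
    leaves every noncritical point with a uniform decrease of f.  That property and
    the emptiness of the interior of the critical values exclude oscillations of
    f(Z_j), and then noncritical cluster points. *)
Require Import Defs.
From HB Require Import structures.
From mathcomp Require Import all_boot all_order all_algebra.
From mathcomp Require Import all_classical all_reals all_analysis.
From mathcomp Require Import measurable_realfun.
From mathcomp Require Import ring lra.

Import Order.TTheory GRing.Theory Num.Theory.
Import numFieldNormedType.Exports.

Local Open Scope classical_set_scope.
Local Open Scope ring_scope.

Set Implicit Arguments.
Unset Strict Implicit.
Unset Printing Implicit Defensive.

(** * Limits along ultrafilters *)

Section UltraLimits.
Variables (R : realType) (n : nat).
Implicit Types (u v w : 'rV[R]_n).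

(** The time reversal is dictated by the definition of a conservative field. It integrates a
    supremum of inner products, and evaluating that supremum at one chosen element bounds the
    variation of the potential from below only. Along a forward trajectory the velocity is minus an
    element of the mean field, and this bound has the wrong sign. Along the reversed one the
    velocity v itself lies in the mean field, and the mean over the components of the suprema is at
    least the squared norm of v. Only the chain rule of each single component enters. That chain
    rule concerns curves leaving the origin, and its integrand may be non-measurable on a null set.
    Passing to an arbitrary time interval therefore takes measurability of the support function and
    a comparison of two curves with the same initial segment. Ultrafilters stand in for the
    extraction of subsequences: one ultrafilter yields limits at all real times at once. The steps
    are bounded below by a multiple of 1 / (k + 1), since the sum under the square root grows at
    most linearly; this makes the total time infinite. *)

Lemma nat_ultrafilter : exists2 U : set_system nat, UltraFilter U & \oo `<=` U.
Proof. by have [U [? ?]] := ultraFilterLemma (F := \oo) _; exists U. Qed.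

(** An ultrafilter decides every neighbourhood preimage, so a cluster point supplied by compactness
    is a limit. *)
Lemma compact_ultra_cvg (T : topologicalType) (I : Type) (U : set_system I)
    (A : set T) (y : I -> T) : UltraFilter U -> compact A ->
  U (y @^-1` A) -> exists2 p, A p & y @ U --> p.
Proof.
move=> UU cA UA; have PU : ProperFilter U by exact: ultra_proper.
have [p [Ap clp]] := cA (y @ U) _ UA; exists p => // B Bp.
have [//|UnB] := in_ultra_setVsetC (y @^-1` B) UU.
by have [q [/= nBq Bq]] := clp (~` B) B UnB Bp.
Qed.

Lemma closed_ball_compact u (r : R) : 0 < r -> compact (closed_ball u r).
Proof.
move=> r0; apply: bounded_closed_compact; last exact: closed_ball_closed.
exists (`|u| + r); split; first exact: num_real.
move=> s us v; rewrite closed_ballE// /closed_ball_/= => uv.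
rewrite (le_trans _ (ltW us))// -[v](subKr u) (le_trans (ler_normB _ _))//.
by rewrite lerD2l.
Qed.

Lemma bounded_ultra_cvg (I : Type) (U : set_system I) (y : I -> 'rV[R]_n) (M : R) :
  UltraFilter U -> (forall i, `|y i| <= M) -> exists p : 'rV[R]_n, y @ U --> p.
Proof.
move=> UU yM; have PU : ProperFilter U by exact: ultra_proper.
have M1 : 0 < Num.max M 1 by rewrite lt_max ltr01 orbT.
have cB := closed_ball_compact (u := 0) M1.
have [|p _ yp] := compact_ultra_cvg UU cB (y := y); last by exists p.
apply: filterE => i /=; rewrite closed_ballE ?lt_max ?ltr01 ?orbT//.
by rewrite /closed_ball_/= sub0r normrN le_max yM.
Qed.

Lemma filter_le_cvg (I : Type) (F : set_system I) (a b : I -> R) (x y : R)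
    {PF : ProperFilter F} : a @ F --> x -> b @ F --> y ->
  F [set i | a i <= b i] -> x <= y.
Proof.
move=> ax byy Fab.
rewrite -subr_ge0.
have ba : (b \- a) @ F --> y - x by exact: cvgB byy ax.
apply: (closed_cvg [set z : R | 0 <= z] (@closed_ge R 0) _ _ ba).
by apply: filterS Fab => i /=; rewrite subr_ge0.
Qed.

End UltraLimits.

(** * The Euclidean norm compared with the max norm *)

Section EuclideanNorm.
Variables (R : realType) (n : nat).
Implicit Types (u v w : 'rV[R]_n).

Lemma coord_le_norm u i : `|u 0 i| <= `|u|.
Proof.
rewrite [leRHS]/Num.norm/= mx_normrE; apply/bigmax_geP; right.
by exists (0, i).
Qed.

Lemma norm_le_coord u (M : R) : 0 <= M -> (forall i, `|u 0 i| <= M) -> `|u| <= M.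
Proof.
move=> M0 uM; rewrite [leLHS]/Num.norm/= mx_normrE; apply: bigmax_le => // -[i j] _ /=.
by rewrite (ord1 i).
Qed.

Lemma dotvC u v : dotv u v = dotv v u.
Proof. by apply: eq_bigr => i _; rewrite mulrC. Qed.

Lemma dotvDl u v w : dotv (u + v) w = dotv u w + dotv v w.
Proof. by rewrite /dotv -big_split/=; apply: eq_bigr => i _; rewrite mxE mulrDl. Qed.

Lemma dotvZl (a : R) u v : dotv (a *: u) v = a * dotv u v.
Proof. by rewrite /dotv mulr_sumr; apply: eq_bigr => i _; rewrite mxE mulrA. Qed.

Lemma dotv0l u : dotv 0 u = 0.
Proof. by rewrite /dotv big1// => i _; rewrite mxE mul0r. Qed.

Lemma dotv_suml (I : finType) (F : I -> 'rV[R]_n) u :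
  dotv (\sum_i F i) u = \sum_i dotv (F i) u.
Proof.
elim/big_ind2 : _ => [|a b c d <- <-|//]; [exact: dotv0l|exact: dotvDl].
Qed.

Lemma dotvv_ge0 u : 0 <= dotv u u.
Proof. by apply: sumr_ge0 => i _; rewrite -expr2 sqr_ge0. Qed.

Lemma dotvv_eq0 u : (dotv u u <= 0) = (u == 0).
Proof.
apply/idP/eqP => [u0|->]; last by rewrite dotv0l.
have /eqP := u0; rewrite eq_le in u0 *; move: (dotvv_ge0 u) => uu.
have /eqP : dotv u u == 0 by rewrite eq_le uu andbT.
move/psumr_eq0P => u00 _; apply/rowP => i; rewrite mxE; apply/eqP.
by rewrite -sqrf_eq0 expr2 u00// => j _; rewrite -expr2 sqr_ge0.
Qed.

Lemma norm_dotv_le u v : `|dotv u v| <= n%:R * (`|u| * `|v|).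
Proof.
apply: (le_trans (ler_norm_sum _ _ _)).
apply: (@le_trans _ _ (\sum_(i < n) (`|u| * `|v|))).
  by apply: ler_sum => i _; rewrite normrM ler_pM ?coord_le_norm.
by rewrite sumr_const card_ord mulr_natl.
Qed.

Lemma norm_le_enorm u : `|u| <= enorm u.
Proof.
apply: norm_le_coord; first exact: sqrtr_ge0.
move=> i; rewrite -sqrtr_sqr ler_wsqrtr// /dotv (bigD1 i)//= expr2 lerDl.
by apply: sumr_ge0 => j _; rewrite -expr2 sqr_ge0.
Qed.

Lemma enorm_le_norm u : enorm u <= n%:R * `|u|.
Proof.
rewrite -(ger0_norm (x := n%:R * `|u|)) ?mulr_ge0// -sqrtr_sqr ler_wsqrtr//.
apply: (le_trans (ler_norm _)); apply: (le_trans (norm_dotv_le _ _)).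
rewrite (_ : (n%:R * `|u|) ^+ 2 = n%:R * n%:R * (`|u| * `|u|)); last by ring.
rewrite ler_wpM2r ?mulr_ge0// -natrM ler_nat.
by case: (n) => // k; rewrite leq_pmulr.
Qed.

Lemma cvg_dotv (I : Type) (F : set_system I) {FF : Filter F}
    (a b : I -> 'rV[R]_n) u v : a @ F --> u -> b @ F --> v ->
  dotv (a i) (b i) @[i --> F] --> dotv u v.
Proof.
move=> au bv; rewrite /dotv; apply: cvg_big => [|i _]; first exact: add_continuous.
apply: cvgM.
  exact: (cvg_comp _ _ au (@coord_continuous _ _ _ 0 i u)).
exact: (cvg_comp _ _ bv (@coord_continuous _ _ _ 0 i v)).
Qed.

End EuclideanNorm.

(** * Almost everywhere differentiability of Lipschitz functions *)

Section LipschitzDerivable.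
Variable R : realType.
Implicit Types g : R -> R.
Local Notation mu := (@lebesgue_measure R).

Lemma lipschitz_continuous (V W : normedModType R) (g : V -> W) (L : R) :
  (forall s t, `|g s - g t| <= L * `|s - t|) -> continuous g.
Proof.
move=> gL x; apply/cvgrPdist_lt => e e0.
near=> y; apply: le_lt_trans (gL x y) _.
have L1 : 0 < `|L| + 1 by rewrite ltr_wpDl.
apply: (@le_lt_trans _ _ ((`|L| + 1) * `|x - y|)).
  by rewrite ler_wpM2r// (le_trans (ler_norm L))// lerDl.
rewrite mulrC -ltr_pdivlMr//; near: y.
by apply: cvgr_dist_lt => //; rewrite divr_gt0.
Unshelve. all: by end_near. Qed.

Definition cumulative_of (F : R -> R) (nd : nondecreasing F) (c : continuous F) :
  cumulative R R :=
  HB.pack_for (cumulative R R) F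
    (isCumulative.Build R _ R F nd (fun x => cvg_at_right_filter (c x))).

Lemma lebesgue_stieltjes_ocitv (F : cumulative R R) (a b : R) : a <= b ->
  lebesgue_stieltjes_measure F `]a, b]%classic = (F b - F a)%:E.
Proof.
move=> ab; rewrite /lebesgue_stieltjes_measure /measure_extension.
rewrite measurable_mu_extE/=; last exact: is_ocitv.
by rewrite wlength_itv_bnd.
Qed.

Lemma ocitv_lebesgue_stieltjes (F : cumulative R R) (X : set R) : ocitv X -> X = set0 \/
  exists a b, [/\ a < b, X = `]a, b]%classic &
   lebesgue_stieltjes_measure F X = (F b - F a)%:E].
Proof.
move=> /ocitvP[->|[[a b] /= ab ->]]; first by left.
by right; exists a, b; split => //; rewrite lebesgue_stieltjes_ocitv// ltW.
Qed.

(* The Stieltjes measures of L t + g t and L t - g t add up to 2 L times Lebesgue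
   measure, so both are absolutely continuous. *)
Lemma lipschitz_lebesgue_stieltjes_null g (L : R) (L0 : 0 < L)
  (gL : forall s t, `|g s - g t| <= L * `|s - t|)
  (F : cumulative R R) (FE : F = (fun t => L * t + g t) :> (R -> R)) (A : set R) :
  measurable A -> mu A = 0%E -> lebesgue_stieltjes_measure F A = 0%E.
Proof.
move=> mA A0.
pose G0 := fun t => L * t - g t.
have ndG : nondecreasing G0.
  move=> s t st; rewrite /G0 -subr_ge0.
  have := gL t s; rewrite (ger0_norm (x := t - s)) ?subr_ge0// ler_norml.
  by move=> /andP[_ h]; lra.
have cG : continuous G0.
  move=> t; apply: cvgB; first by apply: cvgM; [exact: cvg_cst|exact: cvg_id].
  exact: (@lipschitz_continuous R^o R^o g _ gL).
pose G := cumulative_of ndG cG.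
have k0 : 0 <= (2 * L)^-1 by rewrite invr_ge0 mulr_ge0// ltW.
pose nu := mscale (NngNum k0)
   (measure_add (lebesgue_stieltjes_measure F) (lebesgue_stieltjes_measure G)).
have nuE B : nu B = (((2 * L)^-1)%:E * (lebesgue_stieltjes_measure F B +
    lebesgue_stieltjes_measure G B))%E by rewrite -measure_addE.
have muE X : ocitv X -> mu X = nu X.
  move=> oX; have [->|[a [b [ab XE muX]]]] := ocitv_lebesgue_stieltjes F oX.
    by rewrite !measure0.
  rewrite nuE muX XE lebesgue_stieltjes_ocitv ?ltW//.
  rewrite lebesgue_measure_itv/= lte_fin ab -!EFinD -EFinM; congr _%:E.
  have -> : G b - G a = G0 b - G0 a by [].
  by rewrite FE /G0; field; rewrite gt_eqF.
have : mu A = nu A := lebesgue_measure_unique muE mA.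
rewrite A0 nuE => /esym/eqP.
rewrite mule_eq0 eqe invr_eq0 mulf_eq0 pnatr_eq0 (gt_eqF L0)/=.
have a0 := measure_ge0 (lebesgue_stieltjes_measure F) A.
have b0 := measure_ge0 (lebesgue_stieltjes_measure G) A.
by rewrite padde_eq0// => /andP[/eqP].
Qed.

(** Adding a multiple [M * t] makes [g] nondecreasing. The resulting Stieltjes measure is dominated
    by Lebesgue measure, and the fundamental theorem of calculus applied to its Radon-Nikodym
    density differentiates the distribution function almost everywhere; on []a, b[] this function is
    [F0] up to a constant. *)
Lemma lipschitz_ae_derivable g (L : R) a b :
  (forall s t, `|g s - g t| <= L * `|s - t|) ->
  {ae mu, forall t, t \in `]a, b[ -> derivable g t 1}.
Proof.
move=> gL0.
have [M M0 gL] : exists2 M, 0 < M & forall s t, `|g s - g t| <= M * `|s - t|.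
  exists (`|L| + 1); first by rewrite ltr_wpDl.
  by move=> s t; rewrite (le_trans (gL0 s t))// ler_wpM2r// (le_trans (ler_norm L))// lerDl.
have [ab|ba] := ltP a b; last first.
  apply/aeW => t; rewrite in_itv/= => /andP[at_ tb].
  by have := lt_le_trans (lt_trans at_ tb) ba; rewrite ltxx.
pose F0 := fun t => M * t + g t.
have ndF : nondecreasing F0.
  move=> s t st; rewrite /F0 -subr_ge0.
  have := gL t s; rewrite (ger0_norm (x := t - s)) ?subr_ge0// ler_norml.
  by move=> /andP[h _]; lra.
have cF : continuous F0.
  move=> t; apply: cvgD; first by apply: cvgM; [exact: cvg_cst|exact: cvg_id].
  exact: (@lipschitz_continuous R^o R^o g _ gL).
pose F := cumulative_of ndF cF.
have FE : F = F0 :> (R -> R) by [].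
have Foo : (lebesgue_stieltjes_measure F `]a, b]%classic < +oo)%E.
  by rewrite lebesgue_stieltjes_ocitv ?ltry// ltW.
have mab : measurable (`]a, b]%classic : set (measurableTypeR R)) by exact: measurable_itv.
pose nu0 : {finite_measure set (measurableTypeR R) -> \bar R} := mfrestr mab Foo.
pose nu := charge_of_finite_measure nu0.
have nuE A : nu A = lebesgue_stieltjes_measure F (A `&` `]a, b]%classic).
  by [].
have numu : nu `<< mu.
  apply/null_content_dominatesP => A mA A0; rewrite nuE.
  apply: (lipschitz_lebesgue_stieltjes_null M0 gL) => //.
    exact: measurableI.
  apply/eqP; rewrite -measure_le0 -A0 le_measure// ?inE//.
  exact: measurableI.
pose f := fine \o Radon_Nikodym nu mu.
have fE : EFin \o f = Radon_Nikodym nu mu.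
  by apply/funext => t; rewrite /f/= fineK// Radon_Nikodym_fin_num.
have intf : mu.-integrable setT (EFin \o f).
  by rewrite fE; exact: Radon_Nikodym_integrable.
have intfA A : measurable A -> mu.-integrable A (EFin \o f).
  by move=> mA; apply: integrableS intf.
have locf : locally_integrable setT f.
  by apply: open_integrable_locally => //; exact: openT.
have := @FTC1 R f (BRight a) (fun y => intfA _ (measurable_itv _)) locf.
apply: filterS; first exact: (ae_filter_ringOfSetsType mu).
move=> t /= + /[!in_itv]/= /andP[at_ tb].
rewrite lte_fin => /(_ at_)[+ _].
set H := (H in derivable H) => dH.
have HE s : a < s < b -> H s = F0 s - F0 a.
  move=> /andP[as_ sb]; rewrite /H /Rintegral.
  under eq_integral do rewrite -[(f _)%:E]/((EFin \o f) _) fE.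
  rewrite -Radon_Nikodym_integral//.
  change (fine (lebesgue_stieltjes_measure F (`]a, s]%classic `&` `]a, b]%classic)) = F0 s - F0 a).
  rewrite -FE.
  rewrite (_ : _ `&` _ = `]a, s]%classic); last first.
    apply/seteqP; split=> r /=; rewrite !in_itv/=; first by case.
    by move=> /andP[-> rs]; rewrite rs (le_trans rs (ltW sb)).
  by rewrite lebesgue_stieltjes_ocitv ?ltW.
have -> : g = (fun s => F0 s - M * s) by apply/funext => s; rewrite /F0; ring.
apply: derivableB; last by apply: derivableM; [exact: derivable_cst|exact: derivable_id].
have dHc : derivable (fun s => H s + F0 a) t 1.
  by apply: (@derivableD _ R^o R^o H (cst (F0 a))); [exact: dH|exact: derivable_cst].
apply: (near_eq_derivable _ dHc); near=> s; rewrite HE ?subrK//.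
by apply/andP; split; near: s; [exact: lt_nbhsr|exact: lt_nbhsl].
Unshelve. all: by end_near. Qed.
End LipschitzDerivable.

(** * The chain rule along Lipschitz curves *)

Section NullSets.
Local Open Scope ereal_scope.
Context d (T : measurableType d) (R : realType).
Variable mu : {measure set T -> \bar R}.

Import HBNNSimple.

(** Multiplying a simple function below [f] by the indicator of the complement of [Z] keeps its
    integral and places it below [g]. The comparison thus takes place between suprema over simple
    functions, for arbitrary [f] and [g]. *)
Lemma ge0_le_integral_null (f g : T -> \bar R) (Z : set T) :
  measurable Z -> mu Z = 0 -> (forall t, 0 <= f t) -> (forall t, 0 <= g t) ->
  (forall t, ~ Z t -> f t <= g t) -> \int[mu]_t f t <= \int[mu]_t g t.
Proof.
move=> mZ Z0 f0 g0 fg; rewrite !ge0_integralTE//.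
apply: ge_ereal_sup => _ /= [h hf <-].
apply: le_ereal_sup_tmp; exists (sintegral mu (proj_nnsfun h (measurableC mZ))).
  exists (proj_nnsfun h (measurableC mZ)) => //= t.
  rewrite mindicE; case: (pselect (Z t)) => Zt.
    by rewrite memNset ?mulr0//; exact.
  by rewrite mem_set// mulr1; exact: le_trans (hf t) (fg _ Zt).
rewrite -!integralT_nnsfun le_eqVlt; apply/orP; left; apply/eqP.
apply: ae_eq_integral => //; [exact/measurable_EFinP|exact/measurable_EFinP|].
exists Z; split => // t /=; apply: contra_notP => Zt _.
by rewrite mindicE mem_set// mulr1.
Qed.

(* Works on the lower integrals by simple functions, because the integrand in
   [conservative_field] need not be measurable on the exceptional null set. *)
Lemma eq_integral_null (A B Z : set T) (f : T -> \bar R) :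
  measurable Z -> mu Z = 0 -> (forall t, ~ Z t -> A t <-> B t) ->
  \int[mu]_(t in A) f t = \int[mu]_(t in B) f t.
Proof.
move=> mZ Z0 AB; rewrite integral_mkcond [RHS]integral_mkcond.
have ABE t : ~ Z t -> (f \_ A) t = (f \_ B) t.
  move=> Zt; rewrite /patch; case: ifPn => [/set_mem|/negP] At.
    by rewrite mem_set//; exact/AB.
  by rewrite memNset// => Bt; apply: At; apply/mem_set/AB.
rewrite integralE [RHS]integralE; congr (_ - _); apply/eqP; rewrite eq_le;
  apply/andP; split; apply: (ge0_le_integral_null mZ) => // t Zt;
  by rewrite ?funeposE ?funenegE ABE.
Qed.

End NullSets.

(** * Measurability of the support function along a curve *)

Section Support.
Variables (R : realType) (n : nat).
Implicit Types (D : setmap R n) (x v : 'rV[R]_n).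

Definition support D x v : \bar R := ereal_sup [set (dotv l v)%:E | l in D x].

Lemma derivable_cvg_derive1 (P : R -> 'rV[R]_n) (t : R) : derivable P t 1 ->
  h^-1 *: (P (h + t) - P t) @[h --> 0^'] --> derive1 P t.
Proof.
rewrite /derivable /derive1.
have -> : (fun h => h^-1 *: ((P \o shift t) (h *: 1) - P t)) =
          (fun h => h^-1 *: (P (h + t) - P t)).
  by apply/funext => h /=; rewrite [h *: 1]mulr1.
by [].
Qed.

(** A countable family of difference quotients, so that conditions on the derivative become
    countable combinations of open conditions on [t]. *)
Lemma derivable_cvg_seq (P : R -> 'rV[R]_n) (t : R) : derivable P t 1 ->
  k.+1%:R *: (P (k.+1%:R^-1 + t) - P t) @[k --> \oo] --> derive1 P t.
Proof.
move=> /derivable_cvg_derive1 dP.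
have h0 : (k.+1%:R^-1 : R) @[k --> \oo] --> 0^'.
  move=> A /= dA.
  have : \forall k \near \oo, (k.+1%:R^-1 : R) != 0 -> A k.+1%:R^-1 := @cvg_harmonic R _ dA.
  by apply: filterS => k /=; apply; apply: invr_neq0; rewrite pnatr_eq0.
have -> : (fun k : nat => k.+1%:R *: (P (k.+1%:R^-1 + t) - P t)) =
    (fun h => h^-1 *: (P (h + t) - P t)) \o (fun k : nat => k.+1%:R^-1).
  by apply/funext => k /=; rewrite invrK.
exact: (cvg_comp _ _ h0 dP).
Qed.

Lemma locally_bounded_map_ball D x (r : R) : locally_bounded_map D ->
  exists M : R, forall y d, `|x - y| <= r -> D y d -> `|d| <= M.
Proof.
move=> Dlb.
have rr : 0 < `|r| + 1 by rewrite ltr_wpDl.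
have cB := closed_ball_compact (u := x) rr.
have [M DM] := Dlb _ cB; exists M => y d xy Dyd.
apply: (le_trans (norm_le_enorm _)); apply: (DM y) => //.
rewrite closed_ballE// /closed_ball_/= (le_trans xy)//.
by rewrite (le_trans (ler_norm r))// lerDl.
Qed.

Lemma graph_closed_cvg D (I : Type) (F : set_system I) (a b : I -> 'rV[R]_n) x v :
  ProperFilter F -> graph_closed D -> a @ F --> x -> b @ F --> v ->
  F [set i | D (a i) (b i)] -> D x v.
Proof.
move=> PF cD ax bv FD.
have ab : (a i, b i) @[i --> F] --> (x, v) by exact: (cvg_pair ax bv).
exact: (closed_cvg [set xd : 'rV[R]_n * 'rV[R]_n | D xd.1 xd.2] cD FD _ ab).
Qed.

Section MeasurableSupport.
Variables (D : setmap R n) (Dcl : graph_closed D) (Dlb : locally_bounded_map D).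
Variables (P : R -> 'rV[R]_n) (cP : continuous P).

(* Difference quotients are continuous in t, so this is an open set; the support
   function superlevel set is a countable combination of such sets. *)
Let approx_level (c : R) (j k : nat) : set R := [set t | exists yl : 'rV[R]_n * 'rV[R]_n,
  [/\ D yl.1 yl.2, `|yl.1 - P t| < j.+1%:R^-1 &
      c - j.+1%:R^-1 < dotv yl.2 (k.+1%:R *: (P (k.+1%:R^-1 + t) - P t))]].

Let open_approx_level c j k : open (approx_level c j k).
Proof.
have -> : approx_level c j k = \bigcup_(yl in [set yl : 'rV[R]_n * 'rV[R]_n | D yl.1 yl.2])
   ([set t | `|yl.1 - P t| < j.+1%:R^-1] `&`
    [set t | c - j.+1%:R^-1 < dotv yl.2 (k.+1%:R *: (P (k.+1%:R^-1 + t) - P t))]).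
  by apply/seteqP; split => [t [yl [? ? ?]]|t [yl ? [? ?]]]; exists yl.
apply: bigcup_open => -[y l] /= _; apply: openI.
  apply: (@open_comp _ _ (fun t => `|y - P t|) [set z | z < j.+1%:R^-1]); last exact: open_lt.
  by move=> t _; apply: cvg_norm; apply: cvgB; [exact: cvg_cst|exact: cP].
apply: (@open_comp _ _ (fun t : R => dotv l (k.+1%:R *: (P (k.+1%:R^-1 + t) - P t)))
  [set z : R | c - j.+1%:R^-1 < z]); last exact: open_gt.
move=> t _; apply: cvg_dotv; first exact: cvg_cst.
apply: cvgZr; apply: cvgB; last exact: cP.
apply: (cvg_comp (fun s => k.+1%:R^-1 + s) P); last exact: cP.
by apply: cvgD; [exact: cvg_cst|exact: cvg_id].
Qed.

(** From left to right, the slack [j.+1%:R^-1] gives an element strictly above the level, and the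
    quotients converge. From right to left, choosing [k >= j] for every [j] gives elements of [D] at
    points tending to [P t]; local boundedness provides a limit along an ultrafilter, and the closed
    graph puts it in [D (P t)]. *)
Lemma support_ge_approx (c t : R) : derivable P t 1 ->
  (c%:E <= support D (P t) (derive1 P t))%E <->
  forall j K : nat, exists2 k, (K <= k)%N & approx_level c j k t.
Proof.
move=> dP; have uP := derivable_cvg_seq dP; split.
  move=> cS j K.
  have : ((c - j.+1%:R^-1)%:E < support D (P t) (derive1 P t))%E.
    by apply: lt_le_trans cS; rewrite lte_fin gtrBl invr_gt0.
  move=> /ereal_sup_gt[_ [l Dl <-]]; rewrite lte_fin => cl.
  have lu : dotv l (k.+1%:R *: (P (k.+1%:R^-1 + t) - P t)) @[k --> \oo] -->
      dotv l (derive1 P t) by apply: cvg_dotv => //; exact: cvg_cst.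
  have lu' := cvgr_gt _ lu _ cl.
  near \oo => k; exists k; first by near: k; exact: nbhs_infty_ge.
  exists (P t, l); split => //=; first by rewrite subrr normr0 invr_gt0.
  by near: k; exact: lu'.
move=> /(_ _ _)/cid2 => h.
pose k j := sval (h j j).
have kj j : (j <= k j)%N by rewrite /k; case: (h j j).
have /choice[yl ylP] j : exists yl : 'rV[R]_n * 'rV[R]_n,
  [/\ D yl.1 yl.2, `|yl.1 - P t| < j.+1%:R^-1 &
      c - j.+1%:R^-1 < dotv yl.2 ((k j).+1%:R *: (P ((k j).+1%:R^-1 + t) - P t))].
  by rewrite /k; case: (h j j).
have [M DM] := locally_bounded_map_ball (P t) 1 Dlb.
have [U UU oU] := nat_ultrafilter; have PU : ProperFilter U by exact: ultra_proper.
have j0 : (j.+1%:R^-1 : R) @[j --> U] --> 0 by exact: cvg_trans (cvg_app _ oU) cvg_harmonic.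
have [l ylU] : exists l : 'rV[R]_n, (yl j).2 @[j --> U] --> l.
  apply: (@bounded_ultra_cvg _ _ _ _ _ M) => j; have [Dj yj _] := ylP j.
  apply: (DM (yl j).1) => //; rewrite distrC (le_trans (ltW yj))//.
  by rewrite invf_le1// ler1n.
have y1U : (yl j).1 @[j --> U] --> P t.
  apply/cvgrPdist_lt => e e0; near=> j; have [_ yj _] := ylP j.
  rewrite distrC (lt_trans yj)//; near: j.
  exact: (cvgr_lt _ j0 _ e0).
have Dl : D (P t) l.
  apply: (graph_closed_cvg _ Dcl y1U ylU).
  by apply: filterE => j; case: (ylP j).
apply: (@le_trans _ _ (dotv l (derive1 P t))%:E); last by apply: ereal_sup_ubound; exists l.
have kU : k @ U --> \oo.
  move=> A [m _ mA]; apply: oU; exists m => // j /= mj; apply: mA => /=.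
  exact: leq_trans mj (kj j).
have uU := cvg_comp _ _ kU uP.
rewrite lee_fin.
apply: (@filter_le_cvg _ _ _ (fun j => c - j.+1%:R^-1) _ _ _ PU _ (cvg_dotv ylU uU)).
  by rewrite -[X in _ --> X]subr0; apply: cvgB => //; exact: cvg_cst.
by apply: filterE => j /=; have [_ _ /ltW] := ylP j.
Unshelve. all: by end_near. Qed.

Lemma measurable_support (E : set R) : measurable E ->
  (forall t, E t -> derivable P t 1) ->
  measurable_fun E (fun t => support D (P t) (derive1 P t)).
Proof.
move=> mE dP; apply: (measurability (@ErealGenCInfty.G R)).
  exact: ErealGenCInfty.measurableE.
move=> _ [_ [c ->] <-].
rewrite (_ : _ `&` _ = E `&` \bigcap_j \bigcap_K \bigcup_(k in [set k | (K <= k)%N])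
   approx_level c j k).
  apply: measurableI => //; apply: bigcapT_measurable => j.
  apply: bigcapT_measurable => K; apply: bigcup_measurable => k _.
  exact: open_measurable.
apply/seteqP; split => t [Et]; rewrite /= ?in_itv/= ?andbT => h; split => //.
  move=> j _ K _; have [k Kk akt] := (support_ge_approx c (dP _ Et)).1 h j K.
  by exists k.
apply/(support_ge_approx c (dP _ Et)) => j K.
by have [k Kk akt] := h j I K I; exists k.
Qed.

End MeasurableSupport.

End Support.

Section ChainRule.
Variables (R : realType) (n : nat).
Implicit Types (c : R -> 'rV[R]_n).
Local Notation mu := (@lebesgue_measure R).

Lemma eq_integral_lebesgue_null (A B Z : set R) (f : R -> \bar R) :
  measurable Z -> mu Z = 0%E -> (forall t, ~ Z t -> A t <-> B t) ->
  (\int[mu]_(t in A) f t = \int[mu]_(t in B) f t)%E.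
Proof. exact: (@eq_integral_null _ (measurableTypeR R) R mu A B Z f). Qed.

Lemma lipschitz_abs_continuous01 c (L : R) :
  (forall s t, `|c s - c t| <= L * `|s - t|) -> abs_continuous01 c.
Proof.
move=> cL e e0.
pose M := n%:R * `|L| + 1.
have M0 : 0 < M by rewrite ltr_wpDl// mulr_ge0.
exists (e / M); first by rewrite divr_gt0.
move=> m a b ab _ /=; rewrite ltr_pdivlMr// => abe; apply: le_lt_trans abe.
rewrite mulr_suml; apply: ler_sum => i _; have [_ aibi _] := ab i.
apply: (le_trans (enorm_le_norm _)).
apply: (@le_trans _ _ (n%:R * (`|L| * (b i - a i)))).
  rewrite ler_wpM2l// (le_trans (cL _ _))// ger0_norm ?subr_ge0//.
  by rewrite ler_wpM2r ?subr_ge0 ?ler_norm.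
by rewrite mulrA mulrC ler_wpM2l ?subr_ge0// /M lerDl.
Qed.

(* Runs along the segment from the origin to c tau on [0, tau], then follows c. *)
Definition from_origin c (tau : R) : R -> 'rV[R]_n :=
  fun t => c (Num.max t tau) + (Num.min t tau / tau - 1) *: c tau.

Lemma from_origin_left c tau t : 0 < tau -> t <= tau ->
  from_origin c tau t = (t / tau) *: c tau.
Proof.
by move=> tau0 tt; rewrite /from_origin max_r// min_l// scalerBl scale1r addrC subrK.
Qed.

Lemma from_origin_right c tau t : 0 < tau -> tau <= t -> from_origin c tau t = c t.
Proof.
move=> tau0 tt; rewrite /from_origin max_l// min_r// divff ?gt_eqF// subrr.
by rewrite scale0r addr0.
Qed.

Lemma maxr_lipschitz (tau s t : R) : `|Num.max s tau - Num.max t tau| <= `|s - t|.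
Proof.
case: (leP s tau) => hs; case: (leP t tau) => ht.
- by rewrite subrr normr0.
- rewrite distrC [leRHS]distrC !gtr0_norm ?subr_gt0//; first by rewrite lerB.
  exact: le_lt_trans ht.
- by rewrite !gtr0_norm ?subr_gt0// ?lerB//; exact: le_lt_trans hs.
- by [].
Qed.

Lemma minr_lipschitz (tau s t : R) : `|Num.min s tau - Num.min t tau| <= `|s - t|.
Proof.
case: (leP s tau) => hs; case: (leP t tau) => ht.
- by [].
- by rewrite distrC [leRHS]distrC !ger0_norm ?subr_ge0 ?lerB// ltW// (le_lt_trans hs).
- by rewrite !ger0_norm ?subr_ge0 ?lerB// ltW// (le_lt_trans ht).
- by rewrite subrr normr0.
Qed.

Lemma from_origin_lipschitz c tau (L : R) : 0 < tau ->
  (forall s t, `|c s - c t| <= L * `|s - t|) ->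
  exists M, forall s t, `|from_origin c tau s - from_origin c tau t| <= M * `|s - t|.
Proof.
move=> tau0 cL; exists (`|L| + `|c tau| / tau) => s t.
rewrite /from_origin opprD addrACA -scalerBl.
apply: (le_trans (ler_normD _ _)); rewrite mulrDl; apply: lerD.
  apply: (le_trans (cL _ _)); apply: (@le_trans _ _ (`|L| * `|Num.max s tau - Num.max t tau|)).
    by rewrite ler_wpM2r// ler_norm.
  by rewrite ler_wpM2l// maxr_lipschitz.
rewrite normrZ opprB addrA subrK -mulrBl normrM (gtr0_norm (x := tau^-1)) ?invr_gt0//.
rewrite -[leLHS]mulrA [`|c tau| * tau^-1]mulrC [leRHS]mulrC ler_wpM2r ?minr_lipschitz//.
by rewrite mulr_ge0// invr_ge0 ltW.
Qed.

Variables (h : 'rV[R]_n -> R) (D : setmap R n) (hD : conservative_field h D).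

Lemma conservative_from_origin c tau (L : R) : 0 < tau < 1 ->
  (forall s t, `|c s - c t| <= L * `|s - t|) ->
  ((h (c 1))%:E = (h 0)%:E + \int[mu]_(s in `[0%R, 1%R])
     support D (from_origin c tau s) (derive1 (from_origin c tau) s))%E.
Proof.
move=> /andP[tau0 tau1] cL; have [_ _ _ chain] := hD.
have [M PM] := from_origin_lipschitz tau0 cL.
apply: chain; first exact: lipschitz_abs_continuous01 PM.
  by rewrite from_origin_left ?ltW// mul0r scale0r.
by rewrite from_origin_right// ltW.
Qed.

(** If [D x] were empty, a curve that rests at [x] during []1/2, 1]] would have integrand -oo on a
    set of positive measure, whereas the potential takes finite values. *)
Lemma conservative_field_nonempty x : D x !=set0.
Proof.
apply/set0P/negP => /eqP Dx0.
have half0 : (0 : R) < 2^-1 by lra.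
have half1 : (2^-1 : R) < 1 by lra.
have half : ((0 : R) < 2^-1) && ((2^-1 : R) < 1) by rewrite half0 half1.
have cstL (s t : R) : `|cst x s - cst x t| <= 0 * `|s - t|.
  by rewrite subrr normr0 mul0r.
have := conservative_from_origin half cstL; rewrite integralE.
set f := (X in (\int[_]_(t in _) X^\- t)%E).
suff -> : (\int[mu]_(t in `[0%R, 1%R]) f^\- t)%E = +oo%E.
  (* Since -oo absorbs in [\bar R], the total is -oo whatever the positive part contributes. *)
  by case: (\int[mu]_(t in `[0%R, 1%R]) f^\+ t)%E.
apply/eqP; rewrite -leye_eq.
have A0 : (0 < mu `](2^-1 : R)%R, (1 : R)%R]%classic)%E.
  rewrite lebesgue_measure_itv/= lte_fin half1.
  by rewrite -EFinB lte_fin subr_gt0.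
apply: (@le_trans _ _ (\int[mu]_(t in `](2^-1 : R)%R, (1 : R)%R]) (cst +oo t))%E).
  by rewrite integral_cst// gt0_mulye.
rewrite integral_mkcond [leRHS]integral_mkcond.
apply: (ge0_le_integral_null (Z := set0)) => //.
- by move=> t; apply: erestrict_ge0 => ? _; exact: leey.
- by move=> t; apply: erestrict_ge0 => ? _; exact: funeneg_ge0.
move=> t _; rewrite /patch; case: ifPn => [|_]; last first.
  by case: ifPn => // _; exact: funeneg_ge0.
rewrite inE/= in_itv/= => /andP[ht t1].
rewrite mem_set; last first.
  rewrite /= in_itv/= t1 andbT (le_trans _ (ltW ht))// ltW.
rewrite funenegE /f /support (from_origin_right _ half0 (ltW ht)).
by rewrite Dx0 image_set0 ereal_sup0/= maxye.
Qed.

Lemma support0 x : support D x 0 = 0%E.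
Proof.
have [l Dl] := conservative_field_nonempty x.
apply/eqP; rewrite eq_le; apply/andP; split.
  by apply: ge_ereal_sup => _ [d _ <-]; rewrite dotvC dotv0l.
by apply: ereal_sup_ubound; exists l => //; rewrite dotvC dotv0l.
Qed.

(** The conservative formula is applied to two curves, [c] and the constant [c tau], each preceded
    by the same segment from the origin on [[0, tau]]. Subtraction cancels the segment. Splitting
    the integral at [tau] is where measurability of the support function enters. *)
Lemma chain_rule c (tau L : R) (Z : set R) : 0 < tau < 1 ->
  (forall s t, `|c s - c t| <= L * `|s - t|) ->
  measurable Z -> mu Z = 0%E ->
  (forall t, t \in `]tau, 1[ -> ~ Z t -> derivable c t 1) ->
  (\int[mu]_(t in `]tau, 1%R[%classic `\` Z) support D (c t) (derive1 c t) =
   (h (c 1) - h (c tau))%:E)%E.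
Proof.
move=> tau01 cL mZ Z0 dc; have /andP[tau0 tau1] := tau01.
have [_ Dcl Dlb _] := hD.
pose A1 := `]0, tau[%classic `\` Z; pose A2 := `]tau, 1[%classic `\` Z.
have mA1 : measurable A1 by exact: measurableD.
have mA2 : measurable A2 by exact: measurableD.
have disj : [disjoint A1 & A2].
  apply/eqP/seteqP; split => // t [[/= + _] [/= + _]]; rewrite !in_itv/=.
  by move=> /andP[_ h1] /andP[h2 _]; have := lt_trans h1 h2; rewrite ltxx.
(* The endpoints and the junction [tau], where the concatenated curve may have a corner, are
   discarded with [Z]. *)
pose Z' := Z `|` [set 0; tau; 1].
have mend : measurable ([set 0; tau; 1] : set R) by do !apply: measurableU.
have end0 : mu [set 0; tau; 1] = 0%E.
  by apply/countable_lebesgue_measure0/finite_set_countable.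
have mZ' : measurable Z' by exact: measurableU.
have Z'0 : mu Z' = 0%E.
  by rewrite -Z0; apply: measureU0.
pose lin := fun t : R => (t / tau) *: c tau.
have dlin t : derivable lin t 1.
  apply/derivable_mxP => i j.
  have -> : (fun s : R => lin s i j) = (fun s => s * (tau^-1 * c tau i j)).
    by apply/funext => s; rewrite /lin mxE mulrA.
  by apply: derivableM; [exact: derivable_id|exact: derivable_cst].
have key (g : R -> 'rV[R]_n) (M : R) : (forall s t, `|g s - g t| <= M * `|s - t|) ->
    g tau = c tau -> (forall t, t \in `]tau, 1[ -> ~ Z t -> derivable g t 1) ->
    ((h (g 1))%:E = (h 0)%:E + (\int[mu]_(t in A1) support D (lin t) (derive1 lin t) +
      \int[mu]_(t in A2) support D (g t) (derive1 g t)))%E.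
  move=> gM gc dg; rewrite (conservative_from_origin tau01 gM); congr (_ + _)%E.
  set P := from_origin g tau.
  have nearl t : t < tau -> \forall s \near t, lin s = P s.
    move=> tt; near=> s; rewrite /P from_origin_left ?gc//.
    by apply: ltW; near: s; exact: lt_nbhsl.
  have nearr t : tau < t -> \forall s \near t, g s = P s.
    move=> tt; near=> s; rewrite /P from_origin_right//.
    by apply: ltW; near: s; exact: lt_nbhsr.
  have [M' PM] := from_origin_lipschitz tau0 gM.
  have cP : continuous P by exact: lipschitz_continuous PM.
  clearbody P lin.
  have PE1 t : A1 t -> lin t = P t /\ derive1 lin t = derive1 P t.
    move=> [/= + _]; rewrite in_itv/= => /andP[_ tt].
    have nt := nearl _ tt; split; first exact: nbhs_singleton nt.
    by rewrite !derive1E; exact: near_eq_derive.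
  have PE2 t : A2 t -> g t = P t /\ derive1 g t = derive1 P t.
    move=> [/= + _]; rewrite in_itv/= => /andP[tt _].
    have nt := nearr _ tt; split; first exact: nbhs_singleton nt.
    by rewrite !derive1E; exact: near_eq_derive.
  transitivity (\int[mu]_(t in A1 `|` A2) support D (P t) (derive1 P t))%E.
    apply: (eq_integral_lebesgue_null (fun t => support D (P t) (derive1 P t)) mZ' Z'0) => t Zt.
    rewrite /A1 /A2 /= !in_itv/=; split.
      move=> /andP[t0 t1].
      have nZ : ~ Z t by move=> ?; apply: Zt; left.
      have [tt|tt|tt] := ltgtP t tau.
      - left; split => //; rewrite lt_neqAle t0 !andbT.
        by apply/eqP => t00; apply: Zt; right; left; left.
      - right; split => //; rewrite lt_neqAle t1 !andbT.
        by apply/eqP => t00; apply: Zt; right; right.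
      - by case: Zt; right; left; right.
    move=> [[/andP[t0 tt] _]|[/andP[tt t1] _]].
      by rewrite (ltW t0) ltW// (lt_trans tt).
    by rewrite (ltW t1) andbT ltW// (lt_trans _ tt).
  have mP : measurable_fun (A1 `|` A2) (fun t => support D (P t) (derive1 P t)).
    apply: (measurable_support Dcl Dlb cP); first exact: measurableU.
    move=> t [[/= + _]|[/= + Zt]]; rewrite in_itv/= => /andP[h1 h2].
      exact: near_eq_derivable (nearl _ h2) (dlin t).
    by apply: near_eq_derivable (nearr _ h1) (dg _ _ Zt); rewrite in_itv/= h1 h2.
  have E1 : (\int[mu]_(t in A1) support D (P t) (derive1 P t) =
             \int[mu]_(t in A1) support D (lin t) (derive1 lin t))%E.
    by apply: eq_integral => t /set_mem/PE1[-> ->].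
  have E2 : (\int[mu]_(t in A2) support D (P t) (derive1 P t) =
             \int[mu]_(t in A2) support D (g t) (derive1 g t))%E.
    by apply: eq_integral => t /set_mem/PE2[-> ->].
  by rewrite -E1 -E2; exact: (@integral_setU _ (measurableTypeR R) R mu A1 A2).
have key1 := key _ _ cL erefl dc.
(* The constant curve contributes nothing after [tau], so this isolates the integral over the
   initial segment. *)
have key2 : ((h (c tau))%:E =
    (h 0)%:E + \int[mu]_(t in A1) support D (lin t) (derive1 lin t))%E.
  have cst_lip (s t : R) : `|cst (c tau) s - cst (c tau) t| <= 0 * `|s - t|.
    by rewrite subrr normr0 mul0r.
  have cst_der t : t \in `]tau, 1[ -> ~ Z t -> derivable (cst (c tau) : R -> 'rV[R]_n) t 1.
    by move=> _ _; exact: derivable_cst.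
  have -> := key _ _ cst_lip erefl cst_der.
  rewrite [X in (_ + (_ + X))%E](_ : _ = 0%E) ?adde0//.
  by apply: integral0_eq => t _; rewrite derive1_cst support0.
(* Both left-hand sides are finite, which rules out infinite integrals and allows the
   subtraction. *)
move: key2 key1; case: (\int[mu]_(t in A1) _)%E => [I| |]//; rewrite -EFinD => -[I1].
rewrite -/A2; case: (\int[mu]_(t in A2) _)%E => [J| |]//; rewrite -!EFinD => -[I2].
by rewrite I1 I2; congr _%:E; ring.
Unshelve. all: by end_near. Qed.

End ChainRule.

(** * Convex hulls and the mean field *)

Section ConvexHull.
Variables (R : realType) (n : nat).
Implicit Types (A : set 'rV[R]_n) (u v w : 'rV[R]_n).

Lemma convex_setP A : convex_set (A : set (convex_lmodType 'rV[R]_n)) <->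
  forall u v (t : R), 0 <= t -> t <= 1 -> A u -> A v -> A (t *: u + (1 - t) *: v).
Proof.
split => [cA u v t t0 t1 Au Av|cA u v t Au Av].
  have := cA u v (Itv01 t0 t1); rewrite !inE => /(_ Au Av).
  by [].
move: Au Av; rewrite !inE => Au Av; exact: cA.
Qed.

Lemma convex_convex_hull A u v (t : R) : 0 <= t -> t <= 1 ->
  convex_hull A u -> convex_hull A v -> convex_hull A (t *: u + (1 - t) *: v).
Proof.
move=> t0 t1 Au Av C [cC AC]; move/convex_setP : (cC); apply => //.
  by apply: Au; split.
by apply: Av; split.
Qed.

Lemma sub_convex_hull A : A `<=` convex_hull A.
Proof. by move=> u Au C [_]; exact. Qed.

Lemma convex_hull_min A (C : set 'rV[R]_n) : A `<=` C ->
  (forall u v (t : R), 0 <= t -> t <= 1 -> C u -> C v -> C (t *: u + (1 - t) *: v)) ->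
  convex_hull A `<=` C.
Proof. by move=> AC cC u; apply; split => //; exact/convex_setP. Qed.

Lemma convex_hull_mono A (B : set 'rV[R]_n) : A `<=` B -> convex_hull A `<=` convex_hull B.
Proof.
move=> AB; apply: convex_hull_min => [u /AB|]; first exact: sub_convex_hull.
exact: convex_convex_hull.
Qed.

(** The number [m] of points is a parameter, so that it can be bounded by the dimension. *)
Definition convex_comb A (m : nat) w := exists (a : 'I_m -> R) (s : 'I_m -> 'rV[R]_n),
  [/\ forall i, 0 <= a i, \sum_i a i = 1, forall i, A (s i) & w = \sum_i a i *: s i].

Lemma convex_comb_cat A m1 m2 u v (t : R) : 0 <= t -> t <= 1 ->
  convex_comb A m1 u -> convex_comb A m2 v ->
  convex_comb A (m1 + m2) (t *: u + (1 - t) *: v).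
Proof.
move=> t0 t1 [a [s [a0 a1 As ->]]] [b [r [b0 b1 Ar ->]]].
pose f (i : 'I_(m1 + m2)) :=
  match fintype.split i with inl j => t * a j | inr j => (1 - t) * b j end.
pose g (i : 'I_(m1 + m2)) := match fintype.split i with inl j => s j | inr j => r j end.
have fl j : f (lshift m2 j) = t * a j by rewrite /f (unsplitK (inl j)).
have fr j : f (rshift m1 j) = (1 - t) * b j by rewrite /f (unsplitK (inr j)).
have gl j : g (lshift m2 j) = s j by rewrite /g (unsplitK (inl j)).
have gr j : g (rshift m1 j) = r j by rewrite /g (unsplitK (inr j)).
exists f, g; split.
- by move=> i; rewrite /f; case: fintype.split => j; rewrite mulr_ge0// subr_ge0.
- rewrite big_split_ord/=; under eq_bigr do rewrite fl.
  under [in X in _ + X]eq_bigr do rewrite fr.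
  by rewrite -!mulr_sumr a1 b1; ring.
- by move=> i; rewrite /g; case: fintype.split.
- rewrite big_split_ord/= !scaler_sumr; congr (_ + _).
    by apply: eq_bigr => j _; rewrite fl gl scalerA.
  by apply: eq_bigr => j _; rewrite fr gr scalerA.
Qed.

Lemma convex_comb1 A u : A u -> convex_comb A 1 u.
Proof.
move=> Au; exists (fun=> 1), (fun=> u); split => //; rewrite big_ord1//.
by rewrite scale1r.
Qed.

Lemma convex_hull_comb A u : convex_hull A u -> exists m, convex_comb A m u.
Proof.
apply: (@convex_hull_min A [set u | exists m, convex_comb A m u]) => [w Aw|w v t t0 t1].
  by exists 1%N; exact: convex_comb1.
by move=> [m1 w1] [m2 v2]; exists (m1 + m2)%N; exact: convex_comb_cat.
Qed.

Lemma comb_convex_hull A m u : convex_comb A m u -> convex_hull A u.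
Proof.
elim: m u => [|m IH] u [a [s [a0 a1 As ->]]].
  by move: a1; rewrite big_ord0 => /eqP; rewrite eq_sym oner_eq0.
move: a1; rewrite !big_ord_recl => a1.
have [a01|a01] := eqVneq (a ord0) 1.
  have S0 : \sum_(i < m) a (lift ord0 i) = 0.
    by apply: (addrI (a ord0)); rewrite a1 addr0 a01.
  rewrite a01 scale1r big1 ?addr0; first exact: sub_convex_hull.
  move=> i _; rewrite (_ : a _ = 0) ?scale0r//.
  by have /psumr_eq0P := S0; apply.
have S1 : \sum_(i < m) a (lift ord0 i) = 1 - a ord0 by rewrite -a1; ring.
have a0lt : 0 < 1 - a ord0.
  rewrite lt_neqAle eq_sym subr_eq0 eq_sym a01/= -S1.
  exact: sumr_ge0.
rewrite (_ : \sum_(i < m) _ = (1 - a ord0) *: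
  \sum_(i < m) (a (lift ord0 i) / (1 - a ord0)) *: s (lift ord0 i)); last first.
  rewrite scaler_sumr; apply: eq_bigr => i _.
  by rewrite scalerA mulrCA divff ?gt_eqF// mulr1.
apply: convex_convex_hull => //; first by rewrite -subr_ge0 ltW.
  exact: sub_convex_hull.
apply: IH; exists (fun i => a (lift ord0 i) / (1 - a ord0)), (fun i => s (lift ord0 i)).
split => //; first by move=> i; rewrite mulr_ge0// invr_ge0 ltW.
by rewrite -mulr_suml S1 divff// gt_eqF.
Qed.

(** The [m.+1] vectors [(s i, 1)] lie in dimension [n + 1 < m.+1], hence satisfy a nontrivial linear
    relation [c], whose entries sum to zero. Subtracting [t] times [c] from the weights changes
    neither their sum nor the point. With [t] the least ratio [a i / c 0 i] over the positive
    entries of [c], the weights stay nonnegative and one of them vanishes. *)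
Lemma convex_comb_reduce A m u : (n < m)%N -> convex_comb A m.+1 u -> convex_comb A m u.
Proof.
move=> nm [a [s [a0 a1 As ->]]].
pose M : 'M[R]_(m.+1, n + 1) := row_mx (\matrix_(i, j) s i 0 j) (const_mx 1).
have [c cM c0] : exists2 c : 'rV[R]_m.+1, c *m M = 0 & c != 0.
  apply: contrapT => h.
  have : row_free M.
    apply: inj_row_free => v vM; apply/eqP/negP => /negP v0; apply: h; by exists v.
  rewrite /row_free => /eqP rM; have := rank_leq_col M.
  by rewrite rM addn1 ltnS leqNgt nm.
have [cs c1] : \sum_i c 0 i *: s i = 0 /\ \sum_i c 0 i = 0.
  move: cM; rewrite mul_mx_row -row_mx0 => /eq_row_mx[h1 h2]; split.
    apply/rowP => j; move/rowP : h1 => /(_ j); rewrite !mxE => <-.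
    by rewrite summxE; apply: eq_bigr => i _; rewrite !mxE.
  move/rowP : h2 => /(_ 0); rewrite !mxE => h0.
  by rewrite -[RHS]h0; apply: eq_bigr => i _; rewrite mxE mulr1.
have [i1 ci1] : exists i, 0 < c 0 i.
  apply: contrapT => h; move/negP : c0; apply; apply/eqP/rowP => i; rewrite mxE.
  have cn j : 0 <= - c 0 j by rewrite oppr_ge0 leNgt; apply/negP => cj; apply: h; exists j.
  apply/eqP; rewrite -oppr_eq0; apply/eqP.
  have /psumr_eq0P : \sum_j - c 0 j = 0 by rewrite sumrN c1 oppr0.
  by apply.
pose P := [pred i | 0 < c 0 i].
have Pi1 : P i1 by [].
case: (arg_minP (fun i => a i / c 0 i) Pi1) => i0 /= ci0 mini0.
pose t := a i0 / c 0 i0; pose b i := a i - t * c 0 i.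
have b0 i : 0 <= b i.
  rewrite subr_ge0; have [ci|ci] := ltP 0 (c 0 i).
    by rewrite -ler_pdivlMr//; exact: mini0.
  apply: le_trans (a0 i); rewrite mulr_ge0_le0//.
  by rewrite divr_ge0// ltW.
have bi0 : b i0 = 0 by rewrite /b /t divfK ?subrr// gt_eqF.
exists (fun j => b (lift i0 j)), (fun j => s (lift i0 j)); split => //.
  transitivity (\sum_i b i); first by rewrite [RHS](bigD1_ord i0)//= bi0 add0r.
  by rewrite sumrB a1 -mulr_sumr c1 mulr0 subr0.
transitivity (\sum_i b i *: s i); last first.
  by rewrite (bigD1_ord i0)//= bi0 scale0r add0r.
under [RHS]eq_bigr do rewrite scalerBl -scalerA.
by rewrite sumrB -scaler_sumr cs scaler0 subr0.
Qed.

Lemma caratheodory A u : convex_hull A u -> convex_comb A n.+1 u.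
Proof.
move=> /convex_hull_comb[m mu].
have [v Av] : exists v, A v.
  case: m mu => [|m] [a [s [_ a1 As _]]]; last by exists (s ord0).
  by move: a1; rewrite big_ord0 => /eqP; rewrite eq_sym oner_eq0.
(* Zero weights on a point of [A] lengthen the combination, so the descent below starts at
   [m + n.+1] points for every [m]. *)
have pad k : convex_comb A (m + k) u.
  elim: k => [|k IH]; first by rewrite addn0.
  have := convex_comb_cat ler01 (lexx 1) IH (convex_comb1 Av).
  by rewrite scale1r subrr scale0r addr0 addn1 addnS.
have {pad} := pad n.+1; rewrite addnC.
elim: m {mu} => [|m IH]; first by rewrite addn0.
rewrite addnS => /convex_comb_reduce; rewrite addSn => h.
by apply: IH; apply: h; rewrite ltnS leq_addr.
Qed.

Lemma dotv_convex_hull_le A u (M : R) w : (forall v, A v -> dotv v w <= M) ->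
  convex_hull A u -> dotv u w <= M.
Proof.
move=> AM; move: u; apply: convex_hull_min => [//|u v t t0 t1 uM vM].
rewrite dotvDl !dotvZl; apply: (@le_trans _ _ (t * M + (1 - t) * M)).
  by rewrite lerD// ler_wpM2l// subr_ge0.
by rewrite -mulrDl addrCA subrr addr0 mul1r.
Qed.

End ConvexHull.

Section MeanField.
Variables (R : realType) (n N : nat).
Variable Ds : 'I_N -> setmap R n.
Hypothesis Dcl : forall i, graph_closed (Ds i).
Hypothesis Dlb : forall i, locally_bounded_map (Ds i).

(** A form of [expansion] suited to limits: max norm, strict inequalities, and an attained nearby
    element in place of a distance. *)
Definition near_field (D : setmap R n) (e : R) (x d : 'rV[R]_n) :=
  exists z d', [/\ `|z - x| < e, D z d' & `|d - d'| < e].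

Definition near_mean (e : R) (x : 'rV[R]_n) : set 'rV[R]_n :=
  [set N%:R^-1 *: \sum_(i < N) d i | d in
    [set d : 'I_N -> 'rV[R]_n | forall i, near_field (Ds i) e x (d i)]].

(** By Caratheodory's theorem the approximating convex combinations all have [n.+1] points. Their
    weights and the selected elements are then finitely many bounded sequences, which converge along
    one ultrafilter, and the closed graphs put the limits in [Ds i x]. *)
Lemma mean_field_limit x v :
  (forall e : R, 0 < e -> exists2 w, convex_hull (near_mean e x) w & `|v - w| < e) ->
  mean_field Ds x v.
Proof.
move=> H.
have e0 (j : nat) : (0 : R) < j.+1%:R^-1 by [].
(* The components of [q j] are the weights, the base points near [x], the exact elements of the
   fields at these points, and the perturbed elements that enter the combination. *)
have /choice[q qP] (j : nat) : exists q : ('I_n.+1 -> R) *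
    (('I_n.+1 -> 'I_N -> 'rV[R]_n) *
     (('I_n.+1 -> 'I_N -> 'rV[R]_n) * ('I_n.+1 -> 'I_N -> 'rV[R]_n))),
    [/\ forall p, 0 <= q.1 p, \sum_p q.1 p = 1,
      forall p i, [/\ `|q.2.1 p i - x| < j.+1%:R^-1, Ds i (q.2.1 p i) (q.2.2.1 p i) &
        `|q.2.2.2 p i - q.2.2.1 p i| < j.+1%:R^-1] &
      `|v - \sum_p q.1 p *: (N%:R^-1 *: \sum_i q.2.2.2 p i)| < j.+1%:R^-1].
  have [w /caratheodory[a [s [a0 a1 As ->]]] vw] := H _ (e0 j).
  have /choice[d dP] p : exists d : 'I_N -> 'rV[R]_n,
      (forall i, near_field (Ds i) j.+1%:R^-1 x (d i)) /\ N%:R^-1 *: \sum_i d i = s p.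
    by have [d] := As p; exists d.
  have /choice[zd zdP] (pi : 'I_n.+1 * 'I_N) : exists zd : 'rV[R]_n * 'rV[R]_n,
      [/\ `|zd.1 - x| < j.+1%:R^-1, Ds pi.2 zd.1 zd.2 & `|d pi.1 pi.2 - zd.2| < j.+1%:R^-1].
    by have [/(_ pi.2)[z [d' ?]] _] := dP pi.1; exists (z, d').
  exists (a, ((fun p i => (zd (p, i)).1), ((fun p i => (zd (p, i)).2), d))).
  split => [//|//|p i /=|/=]; first exact: (zdP (p, i)).
  have -> : \sum_(p < n.+1) a p *: (N%:R^-1 *: \sum_(i < N) d p i) = \sum_p a p *: s p.
    by apply: eq_bigr => p _; have [_ ->] := dP p.
  exact: vw.
have [U UU oU] := nat_ultrafilter; have PU : ProperFilter U by exact: ultra_proper.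
have j0 : (j.+1%:R^-1 : R) @[j --> U] --> 0.
  exact: cvg_trans (cvg_app _ oU) cvg_harmonic.
have small (f : nat -> 'rV[R]_n) l : (forall j, `|f j - l| < j.+1%:R^-1) -> f j @[j --> U] --> l.
  move=> fl; apply/cvgrPdist_lt => e e_gt0; near=> j.
  rewrite distrC (lt_trans (fl j))//; near: j.
  exact: (cvgr_lt _ j0 _ e_gt0).
have a01 j p : 0 <= (q j).1 p <= 1.
  have [a0 a1 _ _] := qP j; rewrite a0/= -a1 (bigD1 p)//= lerDl.
  exact: sumr_ge0.
have [a aU] : exists a : 'rV[R]_n.+1, (\row_p (q j).1 p) @[j --> U] --> a.
  apply: (@bounded_ultra_cvg _ _ _ _ _ 1) => j; apply: norm_le_coord => // p.
  by rewrite mxE ger0_norm; case/andP: (a01 j p).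
have aUp p : (q j).1 p @[j --> U] --> a 0 p.
  have := cvg_comp _ _ aU (@coord_continuous _ _ _ 0 p a).
  by apply: cvg_trans; apply: near_eq_cvg; near=> j; rewrite /= mxE.
have zU p i : (q j).2.1 p i @[j --> U] --> x.
  by apply: small => j; have [_ _ /(_ p i)[]] := qP j.
have /choice[d dU] (pi : 'I_n.+1 * 'I_N) :
    exists d : 'rV[R]_n, (q j).2.2.1 pi.1 pi.2 @[j --> U] --> d.
  have [M DM] := locally_bounded_map_ball x 1 (Dlb pi.2).
  apply: (@bounded_ultra_cvg _ _ _ _ _ M) => j.
  have [_ _ /(_ pi.1 pi.2)[zx Dz _] _] := qP j.
  apply: DM Dz; rewrite distrC (le_trans (ltW zx))//.
  by rewrite invf_le1// ler1n.
have dUp p i : (q j).2.2.1 p i @[j --> U] --> d (p, i) by exact: dU (p, i).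
have Dd p i : Ds i x (d (p, i)).
  refine (graph_closed_cvg PU (@Dcl i) (zU p i) (dUp p i) _).
  by apply: filterE => j; have [_ _ /(_ p i)[]] := qP j.
have d'U p i : (q j).2.2.2 p i @[j --> U] --> d (p, i).
  have h : (q j).2.2.2 p i - (q j).2.2.1 p i @[j --> U] --> (0 : 'rV[R]_n).
    by apply: small => j; rewrite subr0; have [_ _ /(_ p i)[]] := qP j.
  have -> : (fun j => (q j).2.2.2 p i) =
      (fun j => ((q j).2.2.2 p i - (q j).2.2.1 p i) + (q j).2.2.1 p i).
    by apply/funext => j; rewrite subrK.
  by rewrite -[d (p, i)]add0r; exact: cvgD h (dUp p i).
have vU : \sum_p (q j).1 p *: (N%:R^-1 *: \sum_i (q j).2.2.2 p i) @[j --> U] --> v.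
  by apply: small => j; rewrite distrC; have [] := qP j.
have lU : \sum_p (q j).1 p *: (N%:R^-1 *: \sum_i (q j).2.2.2 p i) @[j --> U] -->
    \sum_p a 0 p *: (N%:R^-1 *: \sum_i d (p, i)).
  apply: cvg_big => [|p _]; first exact: add_continuous.
  apply: cvgZ; first exact: aUp.
  apply: cvgZr; apply: cvg_big => [|i _]; first exact: add_continuous.
  exact: d'U.
rewrite (cvg_unique _ vU lU)//.
apply: (@comb_convex_hull _ _ _ n.+1); exists (a 0), (fun p => N%:R^-1 *: \sum_i d (p, i)).
split => //.
- move=> p; apply: (@filter_le_cvg R _ U (fun=> 0) _ _ _ PU (cvg_cst 0) (aUp p)).
  by apply: filterE => j /=; case/andP: (a01 j p).
- have sU : \sum_p (q j).1 p @[j --> U] --> \sum_p a 0 p.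
    by apply: cvg_big => [|p _]; [exact: add_continuous|exact: aUp].
  have oneU : \sum_p (q j).1 p @[j --> U] --> (1 : R).
    apply: cvg_near_cst; apply: filterE => j; by have [] := qP j.
  by rewrite (cvg_unique _ sU oneU).
- by move=> p; exists (fun i => d (p, i)).
Unshelve. all: by end_near. Qed.

Lemma near_field_mono (D : setmap R n) (e e' : R) x x' d :
  e + `|x - x'| <= e' -> near_field D e x d -> near_field D e' x' d.
Proof.
move=> ee [z [d' [zx Dz dd]]]; exists z, d'; split => //.
  rewrite -[z](subrK x) -addrA (le_lt_trans (ler_normD _ _))//.
  by rewrite (lt_le_trans _ ee)// ltrD2r.
by rewrite (lt_le_trans dd)// (le_trans _ ee)// lerDl.
Qed.

Lemma near_mean_mono (e e' : R) x x' :
  e + `|x - x'| <= e' -> near_mean e x `<=` near_mean e' x'.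
Proof.
move=> ee _ [d dP <-]; exists d => // i; exact: near_field_mono (dP i).
Qed.

Lemma mean_field_near_mean (e : R) x : 0 < e ->
  [set N%:R^-1 *: \sum_(i < N) d i | d in
     [set d : 'I_N -> 'rV[R]_n | forall i, Ds i x (d i)]] `<=` near_mean e x.
Proof.
move=> e0 _ [d dP <-]; exists d => // i; exists x, (d i).
by rewrite !subrr normr0.
Qed.

Lemma mean_field_closed x v :
  (forall e : R, 0 < e -> exists2 y, `|y - x| < e & mean_field Ds y v) ->
  mean_field Ds x v.
Proof.
move=> H; apply: mean_field_limit => e e0; exists v; last by rewrite subrr normr0.
have e2 : 0 < e / 2 by rewrite divr_gt0.
have [y yx myv] := H _ e2; apply: (convex_hull_mono _ myv).
apply: subset_trans; first exact: (@mean_field_near_mean (e / 2)).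
apply: near_mean_mono.
by rewrite [leRHS](splitr e) lerD2l ltW.
Qed.

End MeanField.

(** * Strict ascent along trajectories of the mean field *)

Section Ascent.
Variables (R : realType) (n : nat).
Local Notation mu := (@lebesgue_measure R).

Lemma lipschitz_ae_derivable_rV (c : R -> 'rV[R]_n) (L a b : R) :
  (forall s t, `|c s - c t| <= L * `|s - t|) ->
  exists Z : set R, [/\ measurable Z, mu Z = 0%E &
    forall t, t \in `]a, b[ -> ~ Z t -> derivable c t 1].
Proof.
move=> cL.
have : {ae mu, forall t, forall i : 'I_n, t \in `]a, b[ -> derivable (fun s => c s 0 i) t 1}.
  apply: filter_forall => i; apply: (@lipschitz_ae_derivable _ _ L) => s t.
  apply: le_trans (cL s t); apply: le_trans (coord_le_norm _ i).
  by rewrite !mxE.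
move=> [Z [mZ Z0 sZ]]; exists Z; split => // t tab Zt.
apply/derivable_mxP => i j; rewrite (ord1 i).
apply: contrapT => nd; apply: Zt; apply: sZ => /= /(_ j tab).
exact: nd.
Qed.

Lemma derive1_lipschitz_le (c : R -> 'rV[R]_n) (L t : R) :
  (forall s t, `|c s - c t| <= L * `|s - t|) -> derivable c t 1 -> `|derive1 c t| <= L.
Proof.
move=> cL /derivable_cvg_seq dc.
have ndc : `|k.+1%:R *: (c (k.+1%:R^-1 + t) - c t)| @[k --> \oo] --> `|derive1 c t|.
  exact: cvg_norm.
apply: (filter_le_cvg ndc (cvg_cst L)); apply: filterE => k /=.
rewrite normrZ; apply: (@le_trans _ _ (k.+1%:R * (L * `|k.+1%:R^-1 + t - t|))).
  by rewrite ger0_norm// ler_wpM2l.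
by rewrite addrK ger0_norm// mulrCA divff// mulr1.
Qed.

Variables (N : nat) (fs : 'I_N -> 'rV[R]_n -> R) (Ds : 'I_N -> setmap R n).
Hypothesis N_gt0 : (0 < N)%N.
Hypothesis fs_field : forall i, conservative_field (fs i) (Ds i).

Lemma support_bounded i (c : R -> 'rV[R]_n) (L : R) : 0 <= L ->
  (forall s t, `|c s - c t| <= L * `|s - t|) ->
  exists B : R, forall t, `|1 - t| <= 1 -> derivable c t 1 ->
    (`|support (Ds i) (c t) (derive1 c t)| <= B%:E)%E.
Proof.
move=> L0 cL; have [_ _ Dlb _] := fs_field i.
have [M DM] := locally_bounded_map_ball (c 1) L Dlb.
exists (n%:R * (M * L)) => t t1 dt.
have bnd l : Ds i (c t) l -> `|dotv l (derive1 c t)| <= n%:R * (M * L).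
  move=> Dl; apply: (le_trans (norm_dotv_le _ _)); rewrite ler_wpM2l//.
  apply: ler_pM => //; last exact: derive1_lipschitz_le.
  apply: DM Dl; apply: (le_trans (cL _ _)).
  by rewrite -[leRHS]mulr1 ler_wpM2l.
have [l Dl] := conservative_field_nonempty (fs_field i) (c t).
have : (support (Ds i) (c t) (derive1 c t) <= (n%:R * (M * L))%:E)%E.
  apply: ge_ereal_sup => _ [d Dd <-]; rewrite lee_fin.
  exact: le_trans (ler_norm _) (bnd d Dd).
have : ((- (n%:R * (M * L)))%:E <= support (Ds i) (c t) (derive1 c t))%E.
  apply: (@le_trans _ _ (dotv l (derive1 c t))%:E); last by apply: ereal_sup_ubound; exists l.
  by rewrite lee_fin; have := bnd l Dl; rewrite ler_norml => /andP[].
by case: support => [r| |]//=; rewrite !lee_fin ler_norml => -> ->.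
Qed.

(** By the chain rule [N] times the variation of the mean function is the integral of the sum of the
    supports, which dominates [N] times the squared Euclidean norm of the velocity. Without increase
    the velocity vanishes almost everywhere, so 0 lies in the mean field at times arbitrarily close
    to 1, and closedness carries this to [c 1]. *)
Lemma ascent (c : R -> 'rV[R]_n) (tau L : R) : 0 < tau < 1 -> 0 <= L ->
  (forall s t, `|c s - c t| <= L * `|s - t|) ->
  (forall t, t \in `]tau, 1[ -> derivable c t 1 -> mean_field Ds (c t) (derive1 c t)) ->
  mean_fun fs (c 1) <= mean_fun fs (c tau) ->
  mean_field Ds (c 1) 0.
Proof.
move=> tau01 L0 cL cD fle; have /andP[tau0 tau1] := tau01.
have [Z [mZ Z0 dc]] := lipschitz_ae_derivable_rV tau 1 cL.
pose A : set R := `]tau, 1[%classic `\` Z.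
have mA : measurable A by apply: measurableD => //; exact: measurable_itv.
have dA t : A t -> derivable c t 1 by move=> [/= tt Zt]; exact: dc.
pose phi i t := support (Ds i) (c t) (derive1 c t).
have cc : continuous c by exact: lipschitz_continuous cL.
have mphi i : measurable_fun A (phi i).
  by have [_ Dcl Dlb _] := fs_field i; exact: measurable_support.
have phiB i : exists B : R, forall t, A t -> (`|phi i t| <= B%:E)%E.
  have [B hB] := support_bounded i L0 cL; exists B => t At; apply: hB; last exact: dA.
  case: At => /= + _; rewrite in_itv/= => /andP[h1 h2].
  rewrite ger0_norm; last by rewrite subr_ge0 ltW.
  by rewrite gerBl ltW// (lt_trans tau0).
have finphi i t : A t -> phi i t \is a fin_num.
  have [B hB] := phiB i; move=> /hB; case: (phi i t) => //=.
have muA : (mu A < +oo)%E.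
  apply: (@le_lt_trans _ _ (mu `]tau, 1[%classic)).
    by apply: le_measure; rewrite ?inE//; exact: subDsetl.
  by rewrite lebesgue_measure_itv/= lte_fin tau1 -EFinB ltry.
have intphi i : mu.-integrable A (phi i).
  have [B hB] := phiB i.
  apply: (@le_integrable _ (measurableTypeR R) R mu A mA (phi i) (cst B%:E)) => //.
  - exact: mphi.
  - by move=> t At; apply: (le_trans (hB t At)); rewrite lee_fin ler_norm.
  apply/integrableP; split; first exact: measurable_cst.
  by rewrite integral_cst//= lte_mul_pinfty.
pose S t := (\sum_(i < N) phi i t)%E.
have SE : (\int[mu]_(t in A) S t = (\sum_(i < N) (fs i (c 1) - fs i (c tau)))%:E)%E.
  have -> : (\int[mu]_(t in A) S t = \sum_(i < N) \int[mu]_(t in A) phi i t)%E.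
    exact: (@integral_sum _ (measurableTypeR R) R mu A mA 'I_N phi intphi).
  rewrite -sumEFin; apply: eq_bigr => i _.
  exact: (chain_rule (fs_field i) tau01 cL mZ Z0 dc).
have S_le0 : (\int[mu]_(t in A) S t <= 0)%E.
  rewrite SE lee_fin sumrB subr_le0.
  by move: fle; rewrite /mean_fun ler_pM2l// invr_gt0 ltr0n.
(* A bound for the linear functional given by pairing with the velocity passes from the generators
   of the mean field to their hull; it is then evaluated at the velocity itself. *)
have Sdot t : A t -> ((N%:R * dotv (derive1 c t) (derive1 c t))%:E <= S t)%E.
  move=> At; have tt : t \in `]tau, 1[ by case: At.
  rewrite /S (eq_bigr (fun i => (fine (phi i t))%:E)); last first.
    by move=> i _; rewrite fineK// finphi.
  rewrite sumEFin lee_fin mulrC -ler_pdivlMr ?ltr0n//.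
  apply: (dotv_convex_hull_le _ (cD t tt (dA t At))) => _ [d dP <-].
  rewrite dotvZl dotv_suml mulrC ler_wpM2r ?invr_ge0//.
  apply: ler_sum => i _; rewrite -lee_fin fineK ?finphi//.
  by apply: ereal_sup_ubound; exists (d i).
have S_ge0 t : A t -> (0 <= S t)%E.
  move=> At; apply: le_trans (Sdot t At); rewrite lee_fin mulr_ge0//.
  exact: dotvv_ge0.
have mS : measurable_fun A S by exact: emeasurable_sum.
have absS : (\int[mu]_(t in A) `|S t| = 0)%E.
  apply/eqP; rewrite eq_le integral_ge0// andbT.
  apply: le_trans S_le0; rewrite le_eqVlt; apply/orP; left; apply/eqP.
  by apply: eq_integral => t /set_mem At; rewrite gee0_abs// S_ge0.
have [W [mW W0 sW]] := (@ae_eq_integral_abs _ (measurableTypeR R) R mu A mA S mS).1 absS.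
apply: mean_field_closed.
- by move=> i; have [] := fs_field i.
- by move=> i; have [] := fs_field i.
move=> e e0.
(* For [t] beyond [r] the Lipschitz bound keeps [c t] within [e] of [c 1]; [L + 1] avoids a division
   by zero. *)
pose r := Num.max tau (1 - e / (L + 1)).
have L1 : 0 < L + 1 by rewrite ltr_wpDl.
have r1 : r < 1 by rewrite gt_max tau1 gtrBl divr_gt0.
have [t [tr nZt nWt]] : exists t, [/\ t \in `]r, 1[, ~ Z t & ~ W t].
  apply: contrapT => h.
  have : (mu `]r, 1%R[%classic <= mu (Z `|` W))%E.
    apply: le_measure; rewrite ?inE//; first exact: measurableU.
    by move=> t tr; apply: contrapT => /not_orP[? ?]; apply: h; exists t.
  rewrite (_ : mu (Z `|` W) = 0%E); last first.
    by rewrite -Z0; exact: measureU0.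
  by rewrite lebesgue_measure_itv/= lte_fin r1 -EFinB lee_fin subr_le0 leNgt r1.
move: tr; rewrite in_itv/= gt_max => /andP[/andP[taut et] t1].
have At : A t by split => //=; rewrite in_itv/= taut t1.
have St : S t = 0%E.
  by apply: contrapT => S0; apply: nWt; apply: sW => /= /(_ At).
exists (c t).
  apply: (le_lt_trans (cL _ _)); rewrite distrC ger0_norm; last by rewrite subr_ge0 ltW.
  apply: (@le_lt_trans _ _ ((L + 1) * (1 - t))).
    by apply: ler_wpM2r; [rewrite subr_ge0 ltW|rewrite lerDl].
  by rewrite mulrC -ltr_pdivlMr// ltrBlDl -ltrBlDr.
suff <- : derive1 c t = 0 by apply: cD; [rewrite in_itv/= taut t1|exact: dA].
apply/eqP; rewrite -dotvv_eq0; have := Sdot t At.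
by rewrite St lee_fin pmulr_rle0// ltr0n.
Qed.

End Ascent.

(** * Convergence from local descent *)

Section DescentConvergence.
Variables (R : realType) (n : nat).
Variables (f : 'rV[R]_n -> R) (Crit : set 'rV[R]_n) (z : nat -> 'rV[R]_n) (M : R).
Hypothesis cf : continuous f.
Hypothesis zM : forall k, `|z k| <= M.
Hypothesis z_slow : z k.+1 - z k @[k --> \oo] --> (0 : 'rV[R]_n).
Hypothesis crit_values : [set f x | x in Crit]° = set0.
Hypothesis descent : forall x, ~ Crit x -> forall r : R, 0 < r ->
  exists e rho K, [/\ 0 < e :> R, 0 < rho :> R & forall k, (K <= k)%N -> `|z k - x| < rho ->
    exists l, [/\ (k <= l)%N, forall j, (k <= j <= l)%N -> `|z j - x| < r &
                  f (z l) <= f x - e]].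

(** Some level [c] between [p] and [q] is not a critical value. The last indices below [c] before an
    excursion above [q] accumulate at a point [x], and small increments force [f x = c]. So [x] is
    not critical, and descent brings the values below [c] again while staying in a ball where
    [f < q], that is, before the excursion ends. This contradicts the choice of a last index. *)
Lemma no_upcrossing (p q : R) : p < q ->
  (forall K, exists2 k, (K <= k)%N & f (z k) < p) ->
  (forall K, exists2 k, (K <= k)%N & q < f (z k)) -> False.
Proof.
move=> pq fp fq.
have [c /andP[pc cq] nc] : exists2 c, p < c < q & forall x, Crit x -> f x <> c.
  apply: contrapT => h.
  have : [set f x | x in Crit]° ((p + q) / 2).
    apply: (@filterS _ _ _ [set` `]p, q[]).
      move=> c /=; rewrite in_itv/= => pcq; apply: contrapT => nc; apply: h.
      by exists c => // x Cx fx; apply: nc; exists x.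
    apply: near_in_itvoo.
    by rewrite in_itv/= midf_lt//= midf_lt.
  by rewrite crit_values.
(* The first component is the last index with value at most [c] before the second, at which the
   value exceeds [q]. *)
have /choice[kl klP] (j : nat) : exists kl : nat * nat,
    [/\ (j <= kl.1)%N, f (z kl.1) <= c, (kl.1 < kl.2)%N,
        forall i, (kl.1 < i <= kl.2)%N -> c < f (z i) & q < f (z kl.2)].
  have [k0 jk0 fk0] := fp j; have [l k0l fl] := fq k0.
  pose P := [pred i | (i <= l)%N && (f (z i) <= c)].
  have exP : exists i, P i by exists k0; rewrite /P/= k0l ltW// (lt_trans fk0).
  have Pl i : P i -> (i <= l)%N by case/andP.
  case: (ex_maxnP exP Pl) => k /andP[kl fk] kmax; exists (k, l); split => //=.
  - by apply: leq_trans jk0 _; apply: kmax; rewrite /P/= k0l ltW// (lt_trans fk0).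
  - rewrite ltn_neqAle kl andbT; apply/eqP => kE; move: fl; rewrite -kE ltNge.
    by rewrite (le_trans fk)// ltW.
  - move=> i /andP[ki il]; rewrite ltNge; apply/negP => fi.
    by have := kmax i; rewrite /P/= il fi => /(_ isT); rewrite leqNgt ki.
have [U UU oU] := nat_ultrafilter; have PU : ProperFilter U by exact: ultra_proper.
have kU : (kl j).1 @[j --> U] --> \oo.
  move=> A [m _ mA]; apply: oU; exists m => // j /= mj; apply: mA => /=.
  by have [jk _ _ _ _] := klP j; exact: leq_trans mj jk.
have [x zx] := bounded_ultra_cvg UU (fun j => zM (kl j).1).
have zSx : z (kl j).1.+1 @[j --> U] --> x.
  have -> : (fun j => z (kl j).1.+1) =
      (fun j => (z (kl j).1.+1 - z (kl j).1) + z (kl j).1).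
    by apply/funext => j; rewrite subrK.
  rewrite -[x]add0r; apply: cvgD => //.
  exact: (cvg_comp _ _ kU z_slow).
have fx : f (z (kl j).1) @[j --> U] --> f x by exact: (cvg_comp _ _ zx (@cf x)).
have fSx : f (z (kl j).1.+1) @[j --> U] --> f x by exact: (cvg_comp _ _ zSx (@cf x)).
have fxc : f x = c.
  apply/eqP; rewrite eq_le; apply/andP; split.
    apply: (filter_le_cvg fx (cvg_cst c)); apply: filterE => j.
    by have [] := klP j.
  apply: (filter_le_cvg (cvg_cst c) fSx); apply: filterE => j /=.
  by have [_ _ h1 h2 _] := klP j; apply/ltW/h2; rewrite ltnSn.
have nCx : ~ Crit x by move=> /nc; rewrite fxc.
have [r r0 fr] : exists2 r : R, 0 < r & forall y, `|y - x| < r -> f y < q.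
  have : \forall y \near x, f y < q by apply: (cvgr_lt _ (@cf x)); rewrite fxc.
  move=> /nbhs_ballP[r /= r0 h]; exists r => // y yx; apply: h.
  by rewrite -ball_normE/= distrC.
have [e [rho [K [e0 rho0 H]]]] := descent nCx r0.
have [j [Kj zj fj]] : exists j, [/\ (K <= (kl j).1)%N, `|z (kl j).1 - x| < rho &
    c - e < f (z (kl j).1)].
  have /cvgrPdistC_lt/(_ _ rho0) zrho := zx.
  near U => j; exists j; split.
  - by near: j; exact: (kU _ (nbhs_infty_ge K)).
  - by near: j; exact: zrho.
  - near: j; apply: (cvgr_gt _ fx).
    by rewrite fxc gtrBl.
have [l [kl1 path fl]] := H _ Kj zj.
have [_ fk kl12 above fl2] := klP j.
have l_lt : (l < (kl j).2)%N.
  rewrite ltnNge; apply/negP => ll; have := fr _ (path (kl j).2 _).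
  by rewrite ltNge (ltW fl2) (ltnW kl12) ll => /(_ isT).
move: kl1; rewrite leq_eqVlt => /orP[/eqP kE|kl1].
  by move: fj; rewrite kE ltNge -fxc fl.
have := above l; rewrite kl1 (ltnW l_lt) => /(_ isT).
rewrite ltNge => /negP; apply; apply: (le_trans fl).
by rewrite fxc gerBl ltW.
Unshelve. all: by end_near. Qed.

(** The values return infinitely often to any neighbourhood of [f x], their limit along the
    ultrafilter. If they also stayed infinitely often at distance [e] above or below, two levels in
    between would be visited infinitely often on both sides. *)
Lemma descent_values_cvg : cvgn (fun k => f (z k)).
Proof.
have [U UU oU] := nat_ultrafilter; have PU : ProperFilter U by exact: ultra_proper.
have [x zx] := bounded_ultra_cvg UU zM.
have fx : f (z k) @[k --> U] --> f x by exact: (cvg_comp _ _ zx (@cf x)).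
have near_fx (e : R) K : 0 < e -> exists2 k, (K <= k)%N & `|f x - f (z k)| < e.
  move=> e0; have /cvgrPdist_lt/(_ _ e0) fe := fx; near U => k; exists k.
    by near: k; apply: oU; exact: nbhs_infty_ge.
  by near: k; exact: fe.
apply/cvg_ex; exists (f x); apply/cvgrPdist_lt => e e0.
apply: contrapT => nfar.
have far K : exists2 k, (K <= k)%N & e <= `|f x - f (z k)|.
  apply: contrapT => h; apply: nfar; exists K => // k /= Kk.
  by rewrite ltNge; apply/negP => ek; apply: h; exists k.
have e3 : 0 < e / 3 by rewrite divr_gt0.
have [hi|/existsNP[K1 lo]] := pselect (forall K, exists2 k, (K <= k)%N & f x + e <= f (z k)).
  apply: (@no_upcrossing (f x + e / 3) (f x + 2 * (e / 3))).
  - lra.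
  - move=> K; have [k Kk] := near_fx _ K e3; rewrite ltr_norml => /andP[h _].
    by exists k => //; lra.
  - by move=> K; have [k Kk hk] := hi K; exists k => //; lra.
apply: (@no_upcrossing (f x - 2 * (e / 3)) (f x - e / 3)).
- lra.
- move=> K; have [k] := far (maxn K K1); rewrite geq_max => /andP[Kk K1k].
  rewrite ler_normr => /orP[h|h]; first by exists k => //; lra.
  by case: lo; exists k => //; lra.
- move=> K; have [k Kk] := near_fx _ K e3; rewrite ltr_norml => /andP[_ h].
  by exists k => //; lra.
Unshelve. all: by end_near. Qed.

(** At a noncritical cluster point [x], descent pushes the limit of the values to at most [f x - e],
    while continuity along visits near [x] keeps it at least [f x]. *)
Lemma descent_cluster : cluster (z @ \oo) `<=` Crit.
Proof.
move=> x clx; apply: contrapT => nCx.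
have freq (r : R) K : 0 < r -> exists2 k, (K <= k)%N & `|z k - x| < r.
  move=> r0; have zA : (z @ \oo) (z @` [set k | (K <= k)%N]).
    by exists K => // k Kk; exists k.
  have [y [[k Kk <-] yx]] := clx _ _ zA (nbhsx_ballx x r r0).
  by exists k => //; move: yx; rewrite -ball_normE/= distrC.
have /cvg_ex[/= a fa] := descent_values_cvg.
have [e [rho [K [e0 rho0 H]]]] := descent nCx ltr01.
have ea : a <= f x - e.
  rewrite leNgt; apply/negP => ea.
  have [K1 _ hK1] : \forall k \near \oo, f x - e < f (z k) by apply: (cvgr_gt _ fa).
  have [k] := freq _ (maxn K K1) rho0; rewrite geq_max => /andP[Kk K1k] zk.
  have [l [kl _ fl]] := H _ Kk zk.
  have := hK1 l (leq_trans K1k kl).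
  by rewrite /= ltNge fl.
have xa : f x <= a.
  rewrite leNgt; apply/negP => ax.
  pose m := (a + f x) / 2.
  have [am mf] : a < m /\ m < f x by rewrite /m; split; lra.
  have [K1 _ hK1] : \forall k \near \oo, f (z k) < m by apply: (cvgr_lt _ fa).
  have : \forall y \near x, m < f y by apply: (cvgr_gt _ (@cf x)).
  move=> /nbhs_ballP[r /= r0 h]; have [k K1k zk] := freq _ K1 r0.
  have := hK1 k K1k; rewrite /= ltNge => /negP; apply; apply/ltW/h.
  by rewrite -ball_normE/= distrC.
by move: (le_trans xa ea); rewrite leNgt gtrBl e0.
Qed.

End DescentConvergence.

(** * Inexact subgradient recursions with vanishing steps *)

Section SubgradientRecursion.
Variables (R : realType) (n N : nat).
Variables (fs : 'I_N -> 'rV[R]_n -> R) (Ds : 'I_N -> setmap R n).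
Hypothesis N_gt0 : (0 < N)%N.
Hypothesis fs_field : forall i, conservative_field (fs i) (Ds i).
Variables (z s : nat -> 'rV[R]_n) (a : nat -> R) (M L : R).
Hypothesis zM : forall k, `|z k| <= M.
Hypothesis sL : forall k, `|s k| <= L.
Hypothesis a_gt0 : forall k, 0 < a k.
Hypothesis a_to0 : a @ \oo --> (0 : R).
Hypothesis a_dvg : forall B : R, exists k, B <= \sum_(i < k) a i.
Hypothesis zS : forall k, z k.+1 = z k - a k *: s k.
Hypothesis s_near : forall e : R, 0 < e ->
  exists K, forall k, (K <= k)%N -> near_mean Ds e (z k) (s k).

Let clock k := \sum_(i < k) a i.

Let L_ge0 : 0 <= L. Proof. exact: le_trans (sL 0). Qed.

Let clockD l m : clock (l + m) - clock l = \sum_(i < m) a (l + i)%N.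
Proof.
elim: m => [|m IH]; first by rewrite addn0 subrr big_ord0.
by rewrite addnS /clock !big_ord_recr/= -IH addrAC.
Qed.

Let zD l m : z l - z (l + m)%N = \sum_(i < m) a (l + i)%N *: s (l + i)%N.
Proof.
elim: m => [|m IH]; first by rewrite addn0 subrr big_ord0.
by rewrite addnS zS big_ord_recr/= -IH opprB addrA addrAC.
Qed.

Let clock_le l l' : (l <= l')%N -> clock l <= clock l'.
Proof.
move=> ll; rewrite -subr_ge0 -(subnKC ll) clockD.
by apply: sumr_ge0 => i _; exact: ltW.
Qed.

Let z_lip l l' : (l <= l')%N -> `|z l - z l'| <= L * (clock l' - clock l).
Proof.
move=> ll; rewrite -(subnKC ll) zD clockD mulr_sumr.
apply: (le_trans (ler_norm_sum _ _ _)); apply: ler_sum => i _.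
by rewrite normrZ (ger0_norm (ltW (a_gt0 _))) mulrC ler_wpM2r// ltW.
Qed.

(** The average slope over a block is the combination of the [s i] with weights [a i] divided by the
    elapsed time; the backward difference [z l - z l'] absorbs the sign of the recursion. *)
Let mean_slope_hull (A : set 'rV[R]_n) l l' : (l < l')%N ->
  (forall i, (l <= i < l')%N -> A (s i)) ->
  convex_hull A ((clock l' - clock l)^-1 *: (z l - z l')).
Proof.
move=> ll As; have D0 : 0 < clock l' - clock l.
  apply: (@lt_le_trans _ _ (a l)) => //.
  rewrite (_ : a l = clock l.+1 - clock l); last first.
    by rewrite /clock big_ord_recr/= addrAC subrr add0r.
  by rewrite lerD2r clock_le.
have [m lE] : exists m, l' = (l + m)%N by exists (l' - l)%N; rewrite subnKC// ltnW.
apply: (@comb_convex_hull _ _ _ m).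
exists (fun i => (clock l' - clock l)^-1 * a (l + i)%N), (fun i => s (l + i)%N); split.
- by move=> i; rewrite mulr_ge0 ?invr_ge0 ?ltW.
- by rewrite -mulr_sumr lE -clockD -lE mulVf// gt_eqF.
- by move=> i; apply: As; rewrite leq_addr lE ltn_add2l ltn_ord.
- by rewrite lE zD scaler_sumr; apply: eq_bigr => i _; rewrite scalerA.
Qed.

Let reach k (t : R) : exists l, (k <= l)%N && (clock k + t <= clock l).
Proof.
have [l hl] := a_dvg (clock k + t); exists (maxn k l); rewrite leq_maxl/=.
exact: le_trans hl (clock_le (leq_maxr _ _)).
Qed.

(** First passage of the clock, overshooting by at most one step. For [t <= 0] it equals [k], so the
    limit curve below is defined and Lipschitz on the whole line. *)
Let hit k (t : R) := ex_minn (reach k t).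

Let hit_ge k t : (k <= hit k t)%N.
Proof. by rewrite /hit; case: ex_minnP => l /andP[]. Qed.

Let hit_clock_ge k t : clock k + t <= clock (hit k t).
Proof. by rewrite /hit; case: ex_minnP => l /andP[]. Qed.

Let hit_le k t t' : t <= t' -> (hit k t <= hit k t')%N.
Proof.
move=> tt; rewrite {1}/hit; case: ex_minnP => l _; apply.
rewrite hit_ge/=; apply: le_trans (hit_clock_ge k t').
by rewrite lerD2l.
Qed.

Let hit_clock_le k t (b : R) : (forall i, (k <= i)%N -> a i <= b) ->
  clock (hit k t) <= clock k + Num.max t 0 + b.
Proof.
move=> ab; have b0 : 0 <= b by apply: le_trans (ab k _); rewrite ?ltW.
rewrite /hit; case: ex_minnP => l /andP[kl _] lmin.
have [kE|kl'] := eqVneq k l.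
  rewrite -kE -addrA lerDl addr_ge0//.
  by rewrite le_max lexx orbT.
case: l kl kl' lmin => [|l] kl kl' lmin.
  by move: kl; rewrite leqn0 (negbTE kl').
have kll : (k <= l)%N by rewrite -ltnS ltn_neqAle kl' kl.
have tl : clock l < clock k + t.
  rewrite ltNge; apply/negP => h; have := lmin l; rewrite kll h ltnn.
  by move=> /(_ isT).
rewrite /clock big_ord_recr/= -/(clock l) lerD ?ab//.
by apply: (le_trans (ltW tl)); rewrite lerD2l le_max lexx.
Qed.

Let hit0 k : hit k 0 = k.
Proof.
apply/eqP; rewrite eqn_leq hit_ge andbT /hit; case: ex_minnP => l _; apply.
by rewrite leqnn addr0 lexx.
Qed.

Section Limit.
Variables (U : set_system nat) (kk : nat -> nat).
Hypothesis UU : UltraFilter U.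
Hypothesis kkU : kk @ U --> \oo.

#[local] Instance PU : ProperFilter U. Proof. exact: ultra_proper. Qed.

Let limit_ex (t : R) : exists p : 'rV[R]_n, z (hit (kk j) (1 - t)) @[j --> U] --> p.
Proof. by apply: (bounded_ultra_cvg UU) => j; exact: zM. Qed.

(* The limit of the interpolated process, run backwards in time from t = 1. *)
Let c (t : R) : 'rV[R]_n := sval (cid (limit_ex t)).

Let cP t : z (hit (kk j) (1 - t)) @[j --> U] --> c t.
Proof. by rewrite /c; case: cid. Qed.

Let hit_clock_cvg (t : R) :
  clock (hit (kk j) t) - clock (kk j) @[j --> U] --> Num.max t 0.
Proof.
apply/cvgrPdist_le => e e0.
have [K _ hK] : \forall i \near \oo, `|a i| <= e by exact: (cvgr0_norm_le _ a_to0).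
near=> j; have Kj : (K <= kk j)%N by near: j; exact: (kkU (nbhs_infty_ge K)).
have ub : clock (hit (kk j) t) <= clock (kk j) + Num.max t 0 + e.
  apply: hit_clock_le => i ji; apply: le_trans (ler_norm _) (hK _ _).
  exact: leq_trans ji.
have lb : clock (kk j) + Num.max t 0 <= clock (hit (kk j) t).
  have [t0|t0] := leP t 0; first by rewrite addr0 clock_le.
  exact: hit_clock_ge.
by rewrite ler_norml; apply/andP; split; lra.
Unshelve. all: by end_near. Qed.

Let c_lip u v : `|c u - c v| <= L * `|u - v|.
Proof.
wlog uv : u v / u <= v.
  move=> h; have [/h//|/ltW/h] := leP u v.
  by rewrite distrC [in leRHS]distrC.
have h1 : `|z (hit (kk j) (1 - u)) - z (hit (kk j) (1 - v))| @[j --> U] --> `|c u - c v|.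
  by apply: cvg_norm; apply: cvgB; exact: cP.
have h2 : L * ((clock (hit (kk j) (1 - u)) - clock (kk j)) -
    (clock (hit (kk j) (1 - v)) - clock (kk j))) @[j --> U] -->
    L * (Num.max (1 - u) 0 - Num.max (1 - v) 0).
  by apply: cvgMr; apply: cvgB; exact: hit_clock_cvg.
apply: (@le_trans _ _ (L * (Num.max (1 - u) 0 - Num.max (1 - v) 0))).
  apply: (filter_le_cvg h1 h2); apply: filterE => j /=.
  rewrite distrC opprB addrA subrK; apply: z_lip.
  by apply: hit_le; rewrite lerB.
rewrite ler_wpM2l//; apply: le_trans (ler_norm _) _.
apply: le_trans (maxr_lipschitz _ _ _) _.
have -> : 1 - u - (1 - v) = v - u by ring.
by rewrite distrC.
Qed.

(** A difference quotient of [c] is the limit of average slopes of [z] over windows of duration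
    close to [h]. These slopes lie in the hull of the perturbed means taken over the window, whose
    points are within about [L * h] of its end, hence near [c t]. *)
Let c_derive (t : R) : t < 1 -> derivable c t 1 -> mean_field Ds (c t) (derive1 c t).
Proof.
move=> t1 dc; apply: mean_field_limit.
- by move=> i; have [] := fs_field i.
- by move=> i; have [] := fs_field i.
move=> e e0; have e4 : 0 < e / 4 by rewrite divr_gt0.
have := derivable_cvg_seq dc => /cvgrPdist_lt/(_ _ e4) near_d.
have near_t : \forall k \near \oo, (k.+1%:R^-1 : R) < 1 - t.
  by apply: (cvgr_lt _ cvg_harmonic); rewrite subr_gt0.
have near_e : \forall k \near \oo, L * (k.+1%:R^-1 : R) < e / 4.
  apply: (cvgr_lt (L * 0)); last by rewrite mulr0.
  by apply: cvgMr; exact: cvg_harmonic.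
have [k [kd kt ke]] : exists k, [/\ `|derive1 c t - k.+1%:R *: (c (k.+1%:R^-1 + t) - c t)| < e / 4,
    (k.+1%:R^-1 : R) < 1 - t & L * (k.+1%:R^-1 : R) < e / 4].
  by near \oo => k; exists k; split; near: k.
(* Here [h < 1 - t], so both sampling times [1 - t] and [1 - (h + t)] are nonnegative and the
   elapsed clock time tends to [h]. *)
pose h : R := k.+1%:R^-1; have h0 : 0 < h by rewrite /h.
have qd : `|derive1 c t - h^-1 *: (c (h + t) - c t)| < e / 4 by rewrite /h invrK.
pose lo j := hit (kk j) (1 - (h + t)); pose up j := hit (kk j) (1 - t).
have D_cvg : clock (up j) - clock (lo j) @[j --> U] --> h.
  have hE : h = Num.max (1 - t) 0 - Num.max (1 - (h + t)) 0.
    have [ht0 ht1] : 0 <= 1 - t /\ 0 <= 1 - (h + t) by have kt' : h < 1 - t by []; split; lra.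
    by rewrite !max_l//; ring.
  have -> : (fun j => clock (up j) - clock (lo j)) = (fun j =>
      (clock (up j) - clock (kk j)) - (clock (lo j) - clock (kk j))).
    by apply/funext => j; ring.
  by rewrite [X in _ --> X]hE; apply: cvgB; exact: hit_clock_cvg.
have w_cvg : (clock (up j) - clock (lo j))^-1 *: (z (lo j) - z (up j)) @[j --> U] -->
    h^-1 *: (c (h + t) - c t).
  apply: cvgZ; first by apply: cvgV => //; rewrite gt_eqF.
  by apply: cvgB; exact: cP.
have zup_cvg : z (up j) @[j --> U] --> c t by exact: cP.
have LD_cvg : L * (clock (up j) - clock (lo j)) @[j --> U] --> L * h by exact: cvgMr.
have [K hK] := s_near e4.
have [j [Kj D0 wj zj Lj]] : exists j, [/\ (K <= kk j)%N, 0 < clock (up j) - clock (lo j),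
    `|h^-1 *: (c (h + t) - c t) -
      (clock (up j) - clock (lo j))^-1 *: (z (lo j) - z (up j))| < e / 4,
    `|c t - z (up j)| < e / 4 & L * (clock (up j) - clock (lo j)) < e / 4].
  move/cvgrPdist_lt/(_ _ e4) : w_cvg => w_near.
  move/cvgrPdist_lt/(_ _ e4) : zup_cvg => z_near.
  near U => j; exists j; split.
  - by near: j; exact: (kkU (nbhs_infty_ge K)).
  - by near: j; exact: (cvgr_gt _ D_cvg).
  - by near: j.
  - by near: j.
  - by near: j; exact: (cvgr_lt _ LD_cvg).
exists ((clock (up j) - clock (lo j))^-1 *: (z (lo j) - z (up j))); last first.
  have := ler_normD (derive1 c t - h^-1 *: (c (h + t) - c t)) (h^-1 *: (c (h + t) - c t) -
    (clock (up j) - clock (lo j))^-1 *: (z (lo j) - z (up j))).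
  by rewrite addrA subrK => ?; lra.
apply: mean_slope_hull.
  by rewrite ltnNge; apply/negP => /clock_le; rewrite leNgt -subr_gt0 D0.
move=> i /andP[li iu]; have Ki : (K <= i)%N.
  by apply: leq_trans Kj _; apply: leq_trans li; exact: hit_ge.
apply: near_mean_mono (hK _ Ki).
have : `|z i - z (up j)| < e / 4.
  apply: le_lt_trans (z_lip (ltnW iu)) _; apply: le_lt_trans Lj.
  by rewrite ler_wpM2l// lerB// clock_le.
move=> ziu.
have := ler_normD (z i - z (up j)) (z (up j) - c t).
by rewrite addrA subrK (distrC (z (up j))) => ?; lra.
Unshelve. all: by end_near. Qed.

(** The limit curve ends at [c 1 = x]. Reversal turns the absence of descent after the indices
    [kk j] into an inequality saying that the mean function does not increase on [[1 - T, 1]], and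
    [ascent] then makes [x] critical. *)
Lemma recursion_no_stall (x : 'rV[R]_n) (r : R) : 0 < r -> ~ mean_field Ds x 0 ->
  z (kk j) @[j --> U] --> x ->
  (forall j l, (kk j <= l)%N ->
     (forall i, (kk j <= i <= l)%N -> `|z i - x| < r) ->
     mean_fun fs x - j.+1%:R^-1 < mean_fun fs (z l)) ->
  continuous (mean_fun fs) -> \oo `<=` U -> False.
Proof.
move=> r0 nx zx stall cf oU.
have L1 : 0 < L + 1 by rewrite ltr_wpDl.
(* The second bound makes [L * T <= r / 4], so the iterates remain in the ball of radius [r] during
   a time [T]; the first keeps [1 - T] inside []0, 1[]. *)
pose T : R := Num.min (2^-1) (r / (4 * (L + 1))).
have T0 : 0 < T by rewrite lt_min invr_gt0 ltr0n divr_gt0// mulr_gt0.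
have T1 : T <= 2^-1 by rewrite ge_min lexx.
have LT : L * T <= r / 4.
  apply: (@le_trans _ _ ((L + 1) * (r / (4 * (L + 1))))).
    apply: ler_pM => //; [exact: ltW|by rewrite lerDl|by rewrite ge_min lexx orbT].
  by rewrite le_eqVlt; apply/orP; left; apply/eqP; field; rewrite gt_eqF.
have c1 : c 1 = x.
  have := @cP 1.
  have -> : (fun j => z (hit (kk j) (1 - 1))) = (fun j => z (kk j)).
    by apply/funext => j; rewrite subrr hit0.
  by move=> zc; exact: (cvg_unique _ zc zx).
apply: nx; rewrite -c1.
apply: (ascent N_gt0 fs_field (tau := 1 - T) _ L_ge0 c_lip).
- by apply/andP; split; lra.
- by move=> t; rewrite in_itv/= => /andP[_ t1]; exact: c_derive.
rewrite c1.
have f_cvg : mean_fun fs (z (hit (kk j) T)) @[j --> U] --> mean_fun fs (c (1 - T)).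
  have := cvg_comp _ _ (@cP (1 - T)) (@cf (c (1 - T))).
  by rewrite opprB addrC subrK.
have fx_cvg : mean_fun fs x - j.+1%:R^-1 @[j --> U] --> mean_fun fs x.
  rewrite -[X in _ --> X]subr0; apply: cvgB; first exact: cvg_cst.
  exact: cvg_trans (cvg_app _ oU) cvg_harmonic.
have D_cvg : L * (clock (hit (kk j) T) - clock (kk j)) @[j --> U] --> L * T.
  apply: cvgMr; have := @hit_clock_cvg T; rewrite max_l//; exact: ltW.
apply: (filter_le_cvg fx_cvg f_cvg).
have r4 : 0 < r / 4 by rewrite divr_gt0.
move/cvgrPdist_lt/(_ _ r4) : (zx) => z_near.
near=> j; apply/ltW/stall; first exact: hit_ge.
move=> i /andP[ki il].
have zj : `|x - z (kk j)| < r / 4 by near: j.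
have Dj : L * (clock (hit (kk j) T) - clock (kk j)) < r / 2.
  by near: j; apply: (cvgr_lt _ D_cvg); lra.
have : `|z (kk j) - z i| < r / 2.
  apply: le_lt_trans (z_lip ki) _; apply: le_lt_trans Dj.
  by rewrite ler_wpM2l// lerB// clock_le.
have := ler_normD (x - z (kk j)) (z (kk j) - z i).
rewrite addrA subrK (distrC x (z i)); lra.
Unshelve. all: by end_near. Qed.

End Limit.

(** Failure of the claim with [e], [rho] equal to [j.+1%:R^-1] and [K = j], for every [j], produces
    exactly a stalling sequence. *)
Lemma recursion_descent : continuous (mean_fun fs) ->
  forall x, ~ critical_set (mean_field Ds) x -> forall r : R, 0 < r ->
  exists e rho K, [/\ 0 < e :> R, 0 < rho :> R & forall k, (K <= k)%N -> `|z k - x| < rho ->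
    exists l, [/\ (k <= l)%N, forall j, (k <= j <= l)%N -> `|z j - x| < r &
                  mean_fun fs (z l) <= mean_fun fs x - e]].
Proof.
move=> cf x nx r r0; apply: contrapT => H.
have /choice[kk kkP] (j : nat) : exists k, [/\ (j <= k)%N, `|z k - x| < j.+1%:R^-1 &
    forall l, (k <= l)%N -> (forall i, (k <= i <= l)%N -> `|z i - x| < r) ->
     mean_fun fs x - j.+1%:R^-1 < mean_fun fs (z l)].
  apply: contrapT => h; apply: H; exists j.+1%:R^-1, j.+1%:R^-1, j.
  split => // k jk zk; apply: contrapT => h'; apply: h; exists k; split => // l kl path.
  by rewrite ltNge; apply/negP => fl; apply: h'; exists l.
have [U UU oU] := nat_ultrafilter; have PU' : ProperFilter U by exact: ultra_proper.
have kkU : kk @ U --> \oo.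
  move=> A [m _ mA]; apply: oU; exists m => // j /= mj; apply: mA => /=.
  by have [jk _ _] := kkP j; exact: leq_trans mj jk.
apply: (recursion_no_stall UU kkU r0 nx _ _ cf oU); last first.
  by move=> j; have [] := kkP j.
apply/cvgrPdist_lt => e e0.
have j0 : (j.+1%:R^-1 : R) @[j --> U] --> 0 by exact: cvg_trans (cvg_app _ oU) cvg_harmonic.
near=> j; have [_ zj _] := kkP j; rewrite distrC (lt_trans zj)//; near: j.
exact: (cvgr_lt _ j0 _ e0).
Unshelve. all: by end_near. Qed.

End SubgradientRecursion.

(** * The momentum method with random reshuffling *)

Section Preliminaries.
Variables (R : realType) (n : nat).

Lemma locally_lipschitz_continuous (f : 'rV[R]_n -> R) :
  locally_lipschitz f -> continuous f.
Proof.
move=> fL x; have [V Vx fV] := fL x.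
have [k k0 kf] : exists2 k : R, 0 < k & forall y, V y -> `|f x - f y| <= k * `|x - y|.
  near +oo_R => k; exists k => // y Vy.
  have : k.-lipschitz_V f by near: k; exact: fV.
  by move=> /(_ (x, y)); apply; split => //=; exact: nbhs_singleton Vx.
have FFx : Filter (nbhs x) by exact: nbhs_filter.
apply/cvgrPdist_lt => e e0; have ek : 0 < e / k by rewrite divr_gt0.
have xe : \forall y \near x, `|x - y| < e / k.
  by have := nbhsx_ballx x (e / k) ek; rewrite -ball_normE.
near=> y; have xy : `|x - y| < e / k by near: y.
apply: le_lt_trans (kf y _) _; first by near: y.
by rewrite mulrC -ltr_pdivlMr.
Unshelve. all: by end_near. Qed.

Lemma mean_fun_continuous (N : nat) (fs : 'I_N -> 'rV[R]_n -> R) :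
  (forall i, continuous (fs i)) -> continuous (mean_fun fs).
Proof.
move=> cfs x; have FFx : Filter (nbhs x) by exact: nbhs_filter.
rewrite /mean_fun; apply: cvgMr; apply: cvg_big => [|i _]; first exact: add_continuous.
exact: cfs.
Qed.

Lemma expansion_near_field (D : setmap R n) (d e : R) x w : d < e ->
  expansion D d x w -> near_field D e x w.
Proof.
move=> de [y xy Dy]; have : (edistv w (D y) < e%:E)%E.
  by apply: le_lt_trans Dy _; rewrite lte_fin.
move=> /ereal_inf_lt[_ [v Dv <-]]; rewrite lte_fin => wv.
exists y, v; split => //; first by rewrite (le_lt_trans (norm_le_enorm _))// (le_lt_trans xy).
exact: le_lt_trans (norm_le_enorm _) wv.
Qed.

Lemma near_field_bounded (N : nat) (Ds : 'I_N -> setmap R n) (e M : R) :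
  (forall i, locally_bounded_map (Ds i)) ->
  exists B, forall i x w, `|x| <= M -> near_field (Ds i) e x w -> `|w| <= B.
Proof.
move=> Dlb.
have /choice[B HB] i : exists B, forall x w, `|x| <= M -> near_field (Ds i) e x w -> `|w| <= B.
  have [C DC] := locally_bounded_map_ball 0 (M + e) (Dlb i).
  exists (C + e) => x w xM [y [d [yx Dy wd]]].
  have dC : `|d| <= C.
    apply: DC Dy; rewrite sub0r normrN -[y](subrK x) addrC.
    by rewrite (le_trans (ler_normD _ _))// lerD// ltW.
  by rewrite -[w](subrK d) addrC (le_trans (ler_normD _ _))// lerD// ltW.
exists (\sum_i `|B i|) => i x w xM /(HB i x w xM) wB.
by rewrite (le_trans wB)// (le_trans (ler_norm _))// (bigD1 i)//= lerDl sumr_ge0.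
Qed.

(** An epoch has [N] indices and meets all [N] components, so a section [sg] of the component map is
    injective, hence a permutation that reorders the sum by component. *)
Lemma epoch_near_mean (N : nat) (Ds : 'I_N -> setmap R n) (g : nat -> 'rV[R]_n)
    (idx : nat -> 'I_N) (j : nat) (e : R) (y : 'rV[R]_n) :
  [set idx k | k in [set k | (j * N <= k < j.+1 * N)%N]] = [set: 'I_N] ->
  (forall k, (j * N <= k < j.+1 * N)%N -> near_field (Ds (idx k)) e y (g k)) ->
  near_mean Ds e y (N%:R^-1 *: \sum_(i < N) g (j * N + i)%N).
Proof.
move=> surj near.
have /choice[sg sgP] (p : 'I_N) : exists i : 'I_N, idx (j * N + i)%N = p.
  have : [set idx k | k in [set k | (j * N <= k < j.+1 * N)%N]] p by rewrite surj.
  move=> [k /= /andP[jk kj] kp].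
  have kN : (k - j * N < N)%N by rewrite ltn_subLR// -mulSnr.
  by exists (Ordinal kN); rewrite /= subnKC.
have sg_inj : injective sg by move=> p q pq; rewrite -(sgP p) pq sgP.
exists (fun p => g (j * N + sg p)%N); last by rewrite [in RHS](reindex_inj sg_inj).
move=> p /=; rewrite -{1}(sgP p); apply: near.
by rewrite leq_addr mulSnr ltn_add2l ltn_ord.
Qed.

(** Boundedness replaces uniform continuity: along an ultrafilter on indices where the values stay
    away from [l], [x] and [z \o phi] share a limit point. *)
Lemma cvg_along (f : 'rV[R]_n -> R) (x z : nat -> 'rV[R]_n) (phi : nat -> nat) (M l : R) :
  continuous f -> (forall k, `|x k| <= M) -> phi @ \oo --> \oo ->
  x k - z (phi k) @[k --> \oo] --> (0 : 'rV[R]_n) ->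
  f (z k) @[k --> \oo] --> l -> f (x k) @[k --> \oo] --> l.
Proof.
move=> cf xM phioo xz fz; apply/cvgrPdist_lt => e e0; apply: contrapT => nfar.
have /choice[k kP] j : exists k, (j <= k)%N /\ e <= `|l - f (x k)|.
  apply: contrapT => h; apply: nfar; exists j => // k /= jk.
  by rewrite ltNge; apply/negP => ek; apply: h; exists k.
have [U UU oU] := nat_ultrafilter; have PU : ProperFilter U by exact: ultra_proper.
have kU : k @ U --> \oo.
  move=> A [m _ mA]; apply: oU; exists m => // j /= mj; apply: mA => /=.
  by have [jk _] := kP j; exact: leq_trans mj jk.
have [p xp] := bounded_ultra_cvg UU (fun j => xM (k j)).
have zp : z (phi (k j)) @[j --> U] --> p.
  have -> : (fun j => z (phi (k j))) = (fun j => x (k j) - (x (k j) - z (phi (k j)))).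
    by apply/funext => j; rewrite subKr.
  rewrite -[p]subr0; apply: cvgB => //; exact: (cvg_comp _ _ kU xz).
have fxp : f (x (k j)) @[j --> U] --> f p by exact: (cvg_comp _ _ xp (@cf p)).
have fzp : f (z (phi (k j))) @[j --> U] --> f p by exact: (cvg_comp _ _ zp (@cf p)).
have kphi : phi (k j) @[j --> U] --> \oo by exact: (cvg_comp _ _ kU phioo).
have fzl : f (z (phi (k j))) @[j --> U] --> l by exact: (cvg_comp _ _ kphi fz).
have lp : l = f p by exact: (cvg_unique _ fzl fzp).
have nd : `|l - f (x (k j))| @[j --> U] --> (0 : R).
  rewrite -(normr0 R) -(subrr l); apply: cvg_norm; apply: cvgB; first exact: cvg_cst.
  by rewrite lp.
have : e <= 0.
  apply: (filter_le_cvg (cvg_cst e) nd); apply: filterE => j /=.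
  by have [] := kP j.
by rewrite leNgt e0.
Qed.

Lemma cluster_along (x z : nat -> 'rV[R]_n) (phi : nat -> nat) :
  phi @ \oo --> \oo ->
  x k - z (phi k) @[k --> \oo] --> (0 : 'rV[R]_n) ->
  cluster (x @ \oo) `<=` cluster (z @ \oo).
Proof.
move=> phioo xz p clp A B zA /nbhs_ballP[r /= r0 pB].
have r2 : 0 < r / 2 by rewrite divr_gt0.
have phiA : \forall k \near \oo, A (z (phi k)) := phioo _ zA.
have xz2 : \forall k \near \oo, `|x k - z (phi k)| < r / 2.
  by move/cvgrPdistC_lt/(_ _ r2) : xz; apply: filterS => k; rewrite subr0.
have xA : \forall k \near \oo, exists2 u, A u & `|x k - u| < r / 2.
  by near=> k; exists (z (phi k)); near: k.
have [y [[u Au yu] py]] := clp [set y | exists2 u, A u & `|y - u| < r / 2] _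
  xA (nbhsx_ballx p (r / 2) r2).
exists u; split => //; apply: pB; rewrite -ball_normE/= in py *.
by rewrite -[p](subrK y) -addrA (le_lt_trans (ler_normD _ _))// [ltRHS](splitr r) ltrD.
Unshelve. all: by end_near. Qed.

End Preliminaries.

Section Momentum.
Variables (R : realType) (n N : nat).
Variables (fs : 'I_N -> 'rV[R]_n -> R) (Ds : 'I_N -> setmap R n).
Hypothesis N_gt0 : (0 < N)%N.
Hypothesis fs_field : forall i, conservative_field (fs i) (Ds i).
Hypothesis critical_values :
  [set mean_fun fs x | x in critical_set (mean_field Ds)]° = set0.
Variables (beta Mx Mg Mm : R) (x m g : nat -> 'rV[R]_n) (eta : nat -> R) (idx : nat -> 'I_N).
Hypotheses (beta_ge0 : 0 <= beta) (beta_lt1 : beta < 1).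
Hypothesis xM : forall k, `|x k| <= Mx.
Hypothesis gM : forall k, `|g k| <= Mg.
Hypothesis mM : forall k, `|m k| <= Mm.
Hypothesis eta_gt0 : forall k, 0 < eta k.
Hypothesis m_def : forall k, m k.+1 = beta *: m k + (1 - beta) *: g k.
Hypothesis x_def : forall k, x k.+1 = x k - eta k *: m k.+1.
Hypothesis reshuffling : forall j,
  [set idx k | k in [set k | (j * N <= k < j.+1 * N)%N]] = [set: 'I_N].
Hypothesis g_near : forall e : R, 0 < e ->
  exists K, forall k, (K <= k)%N -> near_field (Ds (idx k)) e (x k) (g k).

Let f_cont : continuous (mean_fun fs).
Proof.
apply: mean_fun_continuous => i; apply: locally_lipschitz_continuous.
by have [] := fs_field i.
Qed.

Let N_gt0R : 0 < N%:R :> R. Proof. by rewrite ltr0n. Qed.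

Section VanishingSteps.
Variable C : R.
Hypothesis eta_to0 : eta @ \oo --> (0 : R).
Hypothesis eta_var : forall k, \sum_(i < k) `|eta i.+1 - eta i| <= C.
Hypothesis eta_dvg : forall B : R, exists k, B <= \sum_(i < k) N%:R * eta (i * N)%N.

(** The constant for which [(1 + b) m_(k+1) = b m_k + g_k]. *)
Let b := beta / (1 - beta).
Let b_ge0 : 0 <= b. Proof. by rewrite divr_ge0// subr_ge0 ltW. Qed.
Let Mm_ge0 : 0 <= Mm. Proof. exact: le_trans (mM 0). Qed.
Let Mg_ge0 : 0 <= Mg. Proof. exact: le_trans (gM 0). Qed.

(* The shift by the momentum turns the heavy-ball step into a plain step along g,
   up to an error controlled by the variation of the step size. *)
Let y k := x k - (b * eta k) *: m k.
Let dy k := eta k *: g k + (b * (eta k.+1 - eta k)) *: m k.+1.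

Let yS k : y k.+1 = y k - dy k.
Proof.
apply/rowP => i; rewrite /y /dy x_def m_def !mxE /b; field.
by rewrite gt_eqF// subr_gt0.
Qed.

Let yD k l : y (k + l)%N = y k - \sum_(i < l) dy (k + i)%N.
Proof.
elim: l => [|l IH]; first by rewrite addn0 big_ord0 subr0.
by rewrite addnS yS IH big_ord_recr/= [in RHS]opprD [RHS]addrA.
Qed.

Let W k := \sum_(i < k) `|eta i.+1 - eta i|.

Let WD k l : W (k + l)%N - W k = \sum_(i < l) `|eta (k + i).+1 - eta (k + i)%N|.
Proof.
elim: l => [|l IH]; first by rewrite addn0 subrr big_ord0.
by rewrite addnS /W !big_ord_recr/= -IH addrAC.
Qed.

Let W_nd : nondecreasing_seq W.
Proof.
move=> k l kl; rewrite -subr_ge0 -(subnKC kl) WD.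
by apply: sumr_ge0.
Qed.

Let W_cvg : cvgn W.
Proof.
apply: nondecreasing_is_cvgn; first exact: W_nd.
by exists C => _ [k _ <-]; exact: eta_var.
Qed.

Let W_le_lim k : W k <= limn W.
Proof. exact: nondecreasing_cvgn_le W_nd W_cvg k. Qed.

Let eta_W k l : `|eta (k + l)%N - eta k| <= W (k + l)%N - W k.
Proof.
elim: l => [|l IH]; first by rewrite addn0 !subrr normr0.
rewrite addnS; have -> : W (k + l).+1 = W (k + l)%N + `|eta (k + l).+1 - eta (k + l)%N|.
  by rewrite /W big_ord_recr.
have := ler_normD (eta (k + l).+1 - eta (k + l)%N) (eta (k + l)%N - eta k).
by rewrite addrA subrK; lra.
Qed.

Let a j := N%:R * eta (j * N)%N.
Let s j : 'rV[R]_n := N%:R^-1 *: \sum_(i < N) g (j * N + i)%N.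
Let Q := N%:R * Mg + b * Mm.
Let Q_ge0 : 0 <= Q. Proof. by rewrite addr_ge0// mulr_ge0. Qed.

(** Defect of an epoch regarded as one step of length [a j] along [s j]. Freezing the step size and
    shifting by the momentum both cost a multiple of the variation of [eta] over the epoch, so the
    defects are summable. *)
Let E j := y (j.+1 * N)%N - y (j * N)%N + a j *: s j.

Let E_le j : `|E j| <= Q * (W (j.+1 * N)%N - W (j * N)%N).
Proof.
set k := (j * N)%N; rewrite /E -/k (_ : j.+1 * N = k + N)%N ?mulSnr//.
have -> : y (k + N)%N - y k + a j *: s j = \sum_(i < N)
    ((eta k - eta (k + i)%N) *: g (k + i)%N -
     (b * (eta (k + i).+1 - eta (k + i)%N)) *: m (k + i).+1).
  rewrite yD [X in X + _](_ : _ = - \sum_(i < N) dy (k + i)%N); last first.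
    by rewrite addrAC subrr add0r.
  rewrite /a /s -/k scalerA mulrAC divff ?gt_eqF// mul1r.
  rewrite scaler_sumr -sumrN -big_split/=; apply: eq_bigr => i _.
  by rewrite /dy scalerBl opprD [LHS]addrC addrA.
apply: (le_trans (ler_norm_sum _ _ _)).
apply: (@le_trans _ _ (\sum_(i < N) ((W (k + N)%N - W k) * Mg +
    b * Mm * `|eta (k + i).+1 - eta (k + i)%N|))).
  apply: ler_sum => i _; apply: (le_trans (ler_normB _ _)); apply: lerD.
    rewrite normrZ; apply: ler_pM => //; rewrite distrC.
    apply: (le_trans (eta_W _ _)); rewrite lerD2r; apply: W_nd.
    by rewrite leq_add2l ltnW.
  by rewrite normrZ normrM (ger0_norm b_ge0) mulrAC ler_wpM2r// ler_wpM2l.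
rewrite big_split/= sumr_const card_ord -mulr_sumr -WD.
by rewrite -mulr_natl le_eqVlt; apply/orP; left; apply/eqP; rewrite /Q; ring.
Qed.

Let F j := \sum_(i < j) E i.

Let F_le j l : `|F (j + l)%N - F j| <= Q * (W ((j + l) * N)%N - W (j * N)%N).
Proof.
elim: l => [|l IH]; first by rewrite addn0 !subrr normr0 mulr0.
rewrite addnS; have -> : F (j + l).+1 = F (j + l)%N + E (j + l)%N.
  by rewrite /F big_ord_recr.
rewrite addrAC; apply: (le_trans (ler_normD _ _)).
by have := E_le (j + l); lra.
Qed.

(** The limit of the partial sums is taken along an ultrafilter; letting [l] run in [F_le] gives the
    tail bound. *)
Let F_lim : exists p : 'rV[R]_n, forall j, `|p - F j| <= Q * (limn W - W (j * N)%N).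
Proof.
have [U UU oU] := nat_ultrafilter; have PU : ProperFilter U by exact: ultra_proper.
have F_bounded j : `|F j| <= Q * C.
  have := F_le 0 j; rewrite add0n mul0n /F big_ord0 subr0 => /le_trans; apply.
  by rewrite ler_wpM2l// /W big_ord0 subr0.
have [p Fp] := bounded_ultra_cvg UU F_bounded; exists p => j.
have nFp : `|F l - F j| @[l --> U] --> `|p - F j|.
  by apply: cvg_norm; apply: cvgB => //; exact: cvg_cst.
apply: (filter_le_cvg nFp (cvg_cst _)); apply: oU; exists j => // l /= jl.
rewrite -(subnKC jl); apply: (le_trans (F_le _ _)).
by rewrite ler_wpM2l// lerD2r.
Qed.

Let Finf := sval (cid F_lim).
Let FinfP j : `|Finf - F j| <= Q * (limn W - W (j * N)%N).
Proof. by rewrite /Finf; case: cid. Qed.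

(* Adding the tail of the summable errors makes the epoch recursion exact. *)
Let Z j := y (j * N)%N + (Finf - F j).

Let ZS j : Z j.+1 = Z j - a j *: s j.
Proof.
rewrite /Z (_ : F j.+1 = F j + E j); last by rewrite /F big_ord_recr.
by rewrite /E; apply/rowP => i; rewrite !mxE; ring.
Qed.

Let x_Z_close : x k - Z (k %/ N)%N @[k --> \oo] --> (0 : 'rV[R]_n).
Proof.
(* The three terms bound the motion within an epoch, the momentum shift and the tail of the defects,
   each per unit of [e]; the final 1 makes the inequality strict. *)
pose T := N%:R * Mm + b * Mm + Q + 1.
have T0 : 0 < T by rewrite ltr_wpDl// !addr_ge0// mulr_ge0.
apply/cvgrPdist_lt => e0 e0_gt0; pose e := e0 / T.
have e_gt0 : 0 < e by rewrite divr_gt0.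
have [K1 _ hK1] : \forall k \near \oo, eta k < e by apply: (cvgr_lt _ eta_to0).
have [K2 _ hK2] : \forall k \near \oo, `|limn W - W k| < e.
  by move/cvgrPdist_lt : W_cvg; apply.
exists (maxn K1 K2 + N)%N => // k /= Kk.
set j := (k %/ N)%N.
have kE : k = (j * N + k %% N)%N by rewrite -divn_eq.
have jN : (maxn K1 K2 <= j * N)%N.
  rewrite -(leq_add2r N) (leq_trans Kk)// kE leq_add2l.
  by rewrite ltnW// ltn_mod.
have jN1 : (K1 <= j * N)%N by apply: leq_trans jN; exact: leq_maxl.
have jN2 : (K2 <= j * N)%N by apply: leq_trans jN; exact: leq_maxr.
have xx l : `|x (j * N + l)%N - x (j * N)%N| <= l%:R * (e * Mm).
  elim: l => [|l IH]; first by rewrite addn0 subrr normr0 mul0r.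
  rewrite addnS x_def addrAC (le_trans (ler_normB _ _))// -natr1 mulrDl mul1r lerD//.
  rewrite normrZ (ger0_norm (ltW (eta_gt0 _))); apply: ler_pM => //; first exact: ltW.
  by apply/ltW/hK1 => /=; exact: leq_trans jN1 (leq_addr _ _).
have h1 : `|x k - x (j * N)%N| <= N%:R * (e * Mm).
  rewrite {1}kE; apply: (le_trans (xx _)); apply: ler_wpM2r; first by rewrite mulr_ge0// ltW.
  by rewrite ler_nat ltnW// ltn_mod.
have h2 : `|x (j * N)%N - y (j * N)%N| <= b * e * Mm.
  rewrite /y subKr normrZ normrM (ger0_norm b_ge0) (ger0_norm (ltW (eta_gt0 _))).
  have be : b * eta (j * N)%N <= b * e by rewrite ler_wpM2l//; exact/ltW/hK1.
  by apply: ler_pM => //; rewrite mulr_ge0// ltW.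
have h3 : `|y (j * N)%N - Z j| <= Q * e.
  rewrite /Z opprD addrA subrr add0r normrN (le_trans (FinfP _))// ler_wpM2l//.
  by apply: (le_trans (ler_norm _)); apply/ltW/hK2.
have h4 := ler_normD (x k - x (j * N)%N) (x (j * N)%N - y (j * N)%N).
have h5 := ler_normD (x k - y (j * N)%N) (y (j * N)%N - Z j).
rewrite addrA subrK in h4; rewrite addrA subrK in h5.
rewrite sub0r normrN.
have -> : e0 = T * e by rewrite /e mulrCA divff ?gt_eqF// mulr1.
apply: (@le_lt_trans _ _ ((N%:R * Mm + b * Mm + Q) * e)).
  by lra.
by rewrite ltr_pM2r// /T ltrDl.
Qed.

Let Z_bounded j : `|Z j| <= Mx + b * (eta 0 + C) * Mm + Q * limn W.
Proof.
apply: (le_trans (ler_normD _ _)); apply: lerD.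
  apply: (le_trans (ler_normB _ _)); apply: lerD => //.
  rewrite normrZ normrM (ger0_norm b_ge0) (ger0_norm (ltW (eta_gt0 _))).
  apply: ler_pM => //; first by rewrite mulr_ge0// ltW.
  rewrite ler_wpM2l//.
  have := eta_W 0 (j * N)%N; rewrite add0n ler_norml => /andP[_].
  have W0 : W 0%N = 0 by rewrite /W big_ord0.
  by have : W (j * N)%N <= C := eta_var _; rewrite W0; lra.
apply: (le_trans (FinfP _)); rewrite ler_wpM2l// gerBl.
exact: sumr_ge0.
Qed.

Let s_bounded j : `|s j| <= Mg.
Proof.
rewrite normrZ ger0_norm// mulrC ler_pdivrMr//.
apply: (le_trans (ler_norm_sum _ _ _)).
apply: (@le_trans _ _ (\sum_(i < N) Mg)); first exact: ler_sum.
by rewrite sumr_const card_ord mulr_natr.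
Qed.

Let epoch_to_oo : (fun j => j * N)%N @ \oo --> \oo.
Proof.
move=> A [K _ KA]; exists K => // j /= Kj; apply: KA => /=.
by rewrite (leq_trans Kj)// leq_pmulr.
Qed.

Let div_to_oo : (fun k => k %/ N)%N @ \oo --> \oo.
Proof.
move=> A [K _ KA]; exists (K * N)%N => // k /= Kk; apply: KA => /=.
by rewrite leq_divRL.
Qed.

Let a_to0 : a @ \oo --> (0 : R).
Proof.
rewrite -(mulr0 N%:R); apply: cvgMr.
exact: (cvg_comp _ _ epoch_to_oo eta_to0).
Qed.

Let a_gt0 j : 0 < a j. Proof. by rewrite mulr_gt0. Qed.

Let Z_near (e : R) : 0 < e ->
  exists K, forall j, (K <= j)%N -> near_mean Ds e (Z j) (s j).
Proof.
move=> e0; have e2 : 0 < e / 2 by rewrite divr_gt0.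
have [K1 hK1] := g_near e2.
have [K2 _ hK2] : \forall k \near \oo, `|0 - (x k - Z (k %/ N)%N)| < e / 2.
  by move/cvgrPdist_lt : x_Z_close; apply.
exists (maxn K1 K2) => j; rewrite geq_max => /andP[K1j K2j].
apply: (epoch_near_mean (reshuffling j)) => k /andP[jk kj].
have jlek : (j <= k)%N by rewrite (leq_trans _ jk)// leq_pmulr.
have kN : (k %/ N)%N = j.
  by apply/eqP; rewrite eqn_leq leq_divRL// jk andbT -ltnS ltn_divLR.
apply: near_field_mono (hK1 k (leq_trans K1j jlek)).
have := hK2 k (leq_trans K2j jlek); rewrite /= kN sub0r normrN => h.
by rewrite [leRHS](splitr e) lerD2l ltW.
Qed.

Let Z_slow : Z j.+1 - Z j @[j --> \oo] --> (0 : 'rV[R]_n).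
Proof.
have -> : (fun j => Z j.+1 - Z j) = (fun j => - (a j *: s j)).
  by apply/funext => j; rewrite ZS addrAC subrr add0r.
apply/cvgrPdist_lt => e e0.
have Mg1 : 0 < Mg + 1 by rewrite ltr_wpDl.
have [K _ hK] : \forall j \near \oo, a j < e / (Mg + 1).
  by apply: (cvgr_lt _ a_to0); rewrite divr_gt0.
exists K => // j /= Kj; rewrite sub0r opprK normrZ (ger0_norm (ltW (a_gt0 j))).
apply: (@le_lt_trans _ _ (a j * (Mg + 1))).
  by apply: ler_wpM2l; [exact: ltW|rewrite (le_trans (s_bounded j))// lerDl].
by rewrite -ltr_pdivlMr//; exact: hK.
Qed.

Lemma vanishing_steps_critical :
  cluster (x @ \oo) `<=` critical_set (mean_field Ds) /\ cvgn (fun k => mean_fun fs (x k)).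
Proof.
have descent := recursion_descent N_gt0 fs_field Z_bounded s_bounded a_gt0 a_to0
  eta_dvg ZS Z_near f_cont.
split.
  apply: subset_trans (descent_cluster f_cont Z_bounded Z_slow critical_values descent).
  exact: cluster_along div_to_oo x_Z_close.
have /cvg_ex[/= l fl] := descent_values_cvg f_cont Z_bounded Z_slow critical_values descent.
apply/cvg_ex; exists l; exact: cvg_along f_cont xM div_to_oo x_Z_close fl.
Qed.

End VanishingSteps.

Section VanishingMomentum.
Variable H : R.
Hypothesis eta_le : forall k, eta k <= H.
Hypothesis m_to0 : m @ \oo --> (0 : 'rV[R]_n).

Let x_slow : x k.+1 - x k @[k --> \oo] --> (0 : 'rV[R]_n).
Proof.
have H0 : 0 < H := lt_le_trans (eta_gt0 0) (eta_le 0).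
apply/cvgrPdist_lt => e e0; have eH : 0 < e / H by rewrite divr_gt0.
have [K _ hK] : \forall k \near \oo, `|0 - m k| < e / H.
  by move/cvgrPdist_lt : m_to0; apply.
exists K => // k /= Kk; rewrite x_def addrAC subrr !add0r opprK normrZ.
rewrite (ger0_norm (ltW (eta_gt0 k))).
have := hK k.+1 (leq_trans Kk (leqnSn k)); rewrite /= sub0r normrN ltr_pdivlMr// mulrC.
by apply: le_lt_trans; rewrite ler_wpM2r.
Qed.

Let g_to0 (e : R) : 0 < e -> exists K, forall k, (K <= k)%N -> `|g k| < e.
Proof.
move=> e0; have b1 : 0 < 1 - beta by rewrite subr_gt0.
have e2 : 0 < e * (1 - beta) / 2 by rewrite divr_gt0// mulr_gt0.
have [K _ hK] : \forall k \near \oo, `|0 - m k| < e * (1 - beta) / 2.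
  by move/cvgrPdist_lt : m_to0; apply.
exists K => k Kk.
have h1 := hK k Kk; have h2 := hK k.+1 (leq_trans Kk (leqnSn k)).
rewrite /= sub0r normrN in h1; rewrite /= sub0r normrN in h2.
have gE : (1 - beta) *: g k = m k.+1 - beta *: m k by rewrite m_def addrAC subrr add0r.
rewrite -(ltr_pM2l b1) -(ger0_norm (ltW b1)) -normrZ gE (ger0_norm (ltW b1)).
apply: (le_lt_trans (ler_normB _ _)); rewrite normrZ (ger0_norm beta_ge0).
have : beta * `|m k| <= `|m k| by rewrite ler_piMl// ltW.
lra.
Qed.

(** The vectors [g k] tend to 0 with [m], and the iterates move slowly. The mean of [g] over the
    epoch following a visit near [p] is therefore both small and a perturbed mean at [p]. *)
Lemma vanishing_momentum_stay p : (forall (rho : R) K, 0 < rho ->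
    exists2 k, (K <= k)%N & `|x k - p| < rho) -> mean_field Ds p 0.
Proof.
move=> freq; apply: mean_field_limit.
- by move=> i; have [] := fs_field i.
- by move=> i; have [] := fs_field i.
(* The next full epoch ends within [2 * N] steps of the visit: drift, initial distance and
   inexactness add up to at most [(2 * N + 2) * d]. *)
move=> e e0; pose d := e / (2 * N%:R + 3).
have T0 : 0 < 2 * N%:R + 3 :> R by rewrite ltr_wpDl// mulr_ge0.
have d0 : 0 < d by rewrite divr_gt0.
have dT : d * (2 * N%:R + 3) = e by rewrite /d divfK// gt_eqF.
have [K1 hK1] := g_near d0; have [K2 hK2] := g_to0 d0.
have [K3 _ hK3] : \forall k \near \oo, `|0 - (x k.+1 - x k)| < d.
  by move/cvgrPdist_lt : x_slow; apply.
have [k] := freq d (maxn K1 (maxn K2 K3)) d0; rewrite !geq_max => /and3P[K1k K2k K3k] xk.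
pose j := (k %/ N).+1.
have kj : (k <= j * N)%N by rewrite ltnW// /j -ltn_divLR.
have jk : (j * N <= k + N)%N by rewrite /j mulSnr leq_add2r leq_trunc_div.
have xx l : `|x (k + l)%N - x k| <= l%:R * d.
  elim: l => [|l IH]; first by rewrite addn0 subrr normr0 mul0r.
  have := hK3 (k + l)%N (leq_trans K3k (leq_addr _ _)).
  rewrite /= sub0r normrN addnS => h.
  have := ler_normD (x (k + l).+1 - x (k + l)%N) (x (k + l)%N - x k).
  by rewrite addrA subrK -natr1 mulrDl mul1r; lra.
exists (N%:R^-1 *: \sum_(i < N) g (j * N + i)%N).
  apply: sub_convex_hull; apply: (epoch_near_mean (reshuffling j)) => i /andP[ji ij].
  have ki : (k <= i)%N by exact: leq_trans kj ji.
  apply: near_field_mono (hK1 i (leq_trans K1k ki)).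
  have : `|x i - x k| <= (2 * N%:R) * d.
    rewrite -(subnKC ki); apply: (le_trans (xx _)); apply: ler_wpM2r; first exact: ltW.
    rewrite -natrM ler_nat leq_subLR ltnW// (leq_trans ij)// mulSnr mul2n -addnn addnA leq_add2r//.
  have := ler_normD (x i - x k) (x k - p).
  rewrite addrA subrK -dT; lra.
rewrite sub0r normrN normrZ ger0_norm// mulrC ltr_pdivrMr//.
apply: (le_lt_trans (ler_norm_sum _ _ _)).
apply: (@le_lt_trans _ _ (\sum_(i < N) d)).
  apply: ler_sum => i _; apply/ltW/hK2.
  by apply: leq_trans K2k _; apply: leq_trans kj _; exact: leq_addr.
rewrite sumr_const card_ord -[d *+ N]mulr_natr ltr_pM2r// -[ltRHS]dT ltr_pMr//.
by have := ler0n R N; lra.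
Qed.

(** A noncritical point has a neighbourhood that the iterates eventually avoid, so the descent
    property holds vacuously there and the same convergence argument applies. *)
Lemma vanishing_momentum_critical :
  cluster (x @ \oo) `<=` critical_set (mean_field Ds) /\ cvgn (fun k => mean_fun fs (x k)).
Proof.
have descent p : ~ critical_set (mean_field Ds) p -> forall r : R, 0 < r ->
    exists e rho K, [/\ 0 < e :> R, 0 < rho :> R & forall k, (K <= k)%N -> `|x k - p| < rho ->
    exists l, [/\ (k <= l)%N, forall j, (k <= j <= l)%N -> `|x j - p| < r &
                  mean_fun fs (x l) <= mean_fun fs p - e]].
  move=> np r r0; apply: contrapT => far; apply: np.
  apply: vanishing_momentum_stay => rho K rho0; apply: contrapT => nk; apply: far.
  exists 1, rho, K; split => // k Kk xk; exfalso; apply: nk; by exists k.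
split; first exact: descent_cluster f_cont xM x_slow critical_values descent.
exact: descent_values_cvg f_cont xM x_slow critical_values descent.
Qed.

End VanishingMomentum.

End Momentum.

(** * Total variation and divergence of the step sizes *)

Section StepSizes.
Variable R : realType.

(** Each increment splits into a change of [mu] weighted by at most [rho 0] and a change of [rho]
    weighted by at most [P]; both are monotone, so the bounds telescope. *)
Lemma weighted_step_variation (mu rho : nat -> R) (P : R) (k : nat) :
  (forall i, 0 <= mu i <= P) -> nondecreasing_seq mu ->
  (forall i, 0 <= rho i) -> nonincreasing_seq rho ->
  \sum_(i < k) `|mu i.+1 * rho i.+1 - mu i * rho i| <= 2 * (P * rho 0%N).
Proof.
move=> muP mu_nd rho0 rho_ni.
apply: (@le_trans _ _ (P * (rho 0%N - rho k) + rho 0%N * (mu k - mu 0%N))); last first.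
  have [mu0 _] := andP (muP 0%N); have [_ muk] := andP (muP k).
  have := mulr_ge0 (le_trans mu0 (mu_nd _ _ (leq0n k))) (rho0 k).
  have := ler_wpM2r (rho0 k) muk; have := ler_wpM2l (rho0 0%N) muk.
  have := mulr_ge0 mu0 (rho0 0%N); lra.
elim: k => [|k IH]; first by rewrite big_ord0; lra.
rewrite big_ord_recr/=.
have [mu1 muP1] := andP (muP k.+1).
have hmu : 0 <= mu k.+1 - mu k by rewrite subr_ge0 mu_nd.
have hrho : 0 <= rho k - rho k.+1 by rewrite subr_ge0 rho_ni.
have h0 : rho k <= rho 0%N by exact: rho_ni.
have -> : mu k.+1 * rho k.+1 - mu k * rho k =
  rho k * (mu k.+1 - mu k) - mu k.+1 * (rho k - rho k.+1) by ring.
have := ler_normB (rho k * (mu k.+1 - mu k)) (mu k.+1 * (rho k - rho k.+1)).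
rewrite (ger0_norm (mulr_ge0 (rho0 k) hmu)) (ger0_norm (mulr_ge0 mu1 hrho)).
have := ler_wpM2r hmu h0; have := ler_wpM2r hrho muP1; lra.
Qed.

(** Comparison with the harmonic series: [(i * N).+1 <= N * i.+1], so each term is at least
    [c / i.+1]. *)
Lemma epoch_harmonic_dvg (eta : nat -> R) (c : R) (N : nat) : (0 < N)%N -> 0 < c ->
  (forall k, c / k.+1%:R <= eta k) ->
  forall B : R, exists k, B <= \sum_(i < k) N%:R * eta (i * N)%N.
Proof.
move=> N0 c0 ceta B; apply: contrapT => small; apply: (@dvg_harmonic R).
apply: nondecreasing_is_cvgn.
  by apply/nondecreasing_series => i _ _; rewrite /harmonic/= invr_ge0.
exists (B / c) => _ [k _ <-]; rewrite ler_pdivlMr//.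
apply: (@le_trans _ _ (\sum_(i < k) N%:R * eta (i * N)%N)); last first.
  by apply/ltW; rewrite ltNge; apply/negP => h; apply: small; exists k.
rewrite /series/= big_mkord mulr_suml; apply: ler_sum => i _.
have N0R : 0 < N%:R :> R by rewrite ltr0n.
apply: (@le_trans _ _ (N%:R * (c / (i * N).+1%:R))); last by rewrite ler_wpM2l.
rewrite /harmonic/= [leLHS]mulrC mulrCA ler_wpM2l ?(ltW c0)//.
rewrite ler_pdivlMr ?ltr0n// mulrC -ler_pdivlMr ?invr_gt0 ?ltr0n// invrK.
by rewrite -natrM ler_nat mulnS addnC mulnC -addn1 leq_add2l.
Qed.

End StepSizes.

Section BoundedGrowth.
Variables (R : realType) (n : nat).

Lemma sup_along_le (psi : 'rV[R]_n -> R) (x : nat -> 'rV[R]_n) (M : R) :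
  locally_bounded_fun psi -> (forall k, `|x k| <= M) ->
  exists2 P : R, 0 < P & forall k, sup [set psi (x i) | i in [set i | (i <= k)%N]] <= P.
Proof.
move=> psi_lb xM.
have M1 : 0 < `|M| + 1 by rewrite ltr_wpDl.
have cB := closed_ball_compact (u := 0 : 'rV[R]_n) M1.
have [P hP] := psi_lb _ cB; exists (`|P| + 1); first by rewrite ltr_wpDl.
move=> k; apply: ge_sup; first by exists (psi (x 0%N)), 0%N.
move=> _ [i _ <-]; apply: le_trans (ler_norm _) _.
apply: (@le_trans _ _ P).
  apply: hP; rewrite closed_ballE ?ltr_wpDl// /closed_ball_/= sub0r normrN.
  by rewrite (le_trans (xM i))// (le_trans (ler_norm M))// lerDl.
by rewrite (le_trans (ler_norm P))// lerDl.
Qed.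

End BoundedGrowth.

Unset Implicit Arguments.
Set Strict Implicit.
Set Printing Implicit Defensive.

Theorem theorem3p3 (R : realType) (n N : nat) (n_gt0 : (0 < n)%N) (N_gt0 : (0 < N)%N)
  (fs : 'I_N -> 'rV[R]_n -> R) (Ds : 'I_N -> setmap R n)
  (fs_lip : forall i, locally_lipschitz (fs i))
  (fs_path : forall i, path_differentiable (fs i))
  (fs_field : forall i, conservative_field (fs i) (Ds i))
  (critical_values : [set mean_fun fs x | x in critical_set (mean_field Ds)]° = set0)
  (f_lbound : has_lbound (range (mean_fun fs)))
  (beta eps0 : R) (beta_ge0 : 0 <= beta) (beta_lt1 : beta < 1) (eps0_gt0 : 0 < eps0)
  (x m g : nat -> 'rV[R]_n) (eta mu tau : nat -> R) (idx : nat -> 'I_N)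
  (eta_def : forall k : nat,
     eta k = mu k / Num.sqrt (eps0 + \sum_(1 <= i < k.+1) tau i * enorm (m i) ^+ 2))
  (m_def : forall k : nat, m k.+1 = beta *: m k + (1 - beta) *: g k)
  (x_def : forall k : nat, x k.+1 = x k - eta k *: m k.+1)
  (reshuffling : forall j : nat,
     [set idx k | k in [set k | (j * N <= k < j.+1 * N)%N]] = [set: 'I_N])
  (x_bounded : exists M : R, forall k : nat, enorm (x k) <= M)
  (tau_gt0 : forall k : nat, 0 < tau k) (mu_gt0 : forall k : nat, 0 < mu k)
  (tau_nd : nondecreasing_seq tau) (mu_nd : nondecreasing_seq mu)
  (growth : exists psi : 'rV[R]_n -> R,
     [/\ forall y, 0 <= psi y, locally_bounded_fun psi &
         forall k : nat,
           Num.max (tau k) (mu k) <= sup [set psi (x i) | i in [set i | (i <= k)%N]]])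
  (inexact : exists delta : nat -> R,
     [/\ forall k : nat, 0 <= delta k, delta k @[k --> \oo] --> (0 : R) &
         forall k : nat, expansion (Ds (idx k)) (delta k) (x k) (g k)]) :
  cluster (x @ \oo) `<=` critical_set (mean_field Ds) /\
  cvgn (fun k : nat => mean_fun fs (x k)).
Proof.
have [Mx xM] : exists Mx, forall k, `|x k| <= Mx.
  have [M hM] := x_bounded; exists M => k.
  exact: le_trans (norm_le_enorm _) (hM k).
have [P P0 tau_mu_le] : exists2 P : R, 0 < P & forall k, Num.max (tau k) (mu k) <= P.
  have [psi [_ psi_lb hpsi]] := growth.
  have [P P0 hP] := sup_along_le psi_lb xM; exists P => // k.
  exact: le_trans (hpsi k) (hP k).
have tauP k : tau k <= P by apply: le_trans (tau_mu_le k); rewrite le_max lexx.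
have muP k : mu k <= P by apply: le_trans (tau_mu_le k); rewrite le_max lexx orbT.
have [delta [delta0 delta_to0 g_exp]] := inexact.
have g_near (e : R) : 0 < e ->
    exists K, forall k, (K <= k)%N -> near_field (Ds (idx k)) e (x k) (g k).
  move=> e0; have [K _ hK] : \forall k \near \oo, delta k < e by apply: (cvgr_lt _ delta_to0).
  by exists K => k Kk; exact: expansion_near_field (hK k Kk) (g_exp k).
have [Mg gM] : exists Mg, forall k, `|g k| <= Mg.
  have [K hK] := g_near 1 ltr01.
  have Dlb i : locally_bounded_map (Ds i) by have [] := fs_field i.
  have [B hB] := near_field_bounded 1 Mx Dlb.
  (* [B] bounds the terms from index [K] on, the sum the finitely many earlier ones. *)
  exists (B + \sum_(i < K) `|g i|) => k.
  have S0 : 0 <= \sum_(i < K) `|g i| by exact: sumr_ge0.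
  have [Kk|kK] := leqP K k.
    by rewrite (le_trans (hB _ _ _ (xM k) (hK k Kk)))// lerDl.
  have B0 : 0 <= B by apply: le_trans (hB _ _ _ (xM K) (hK K (leqnn K))).
  rewrite -[leLHS]add0r lerD// (bigD1 (Ordinal kK))//= lerDl.
  exact: sumr_ge0.
have [Mm mM] : exists Mm, forall k, `|m k| <= Mm.
  exists (Num.max `|m 0%N| Mg); elim => [|k IH]; first by rewrite le_max lexx.
  rewrite m_def; apply: (le_trans (ler_normD _ _)).
  have b1 : 0 <= 1 - beta by rewrite subr_ge0 ltW.
  rewrite !normrZ (ger0_norm beta_ge0) (ger0_norm b1).
  have := ler_wpM2l beta_ge0 IH.
  have := ler_wpM2l b1 (le_trans (gM k) (_ : Mg <= Num.max `|m 0%N| Mg)).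
  by rewrite le_max lexx orbT => /(_ isT); lra.
pose S k := \sum_(1 <= i < k.+1) tau i * enorm (m i) ^+ 2.
have SS k : S k.+1 = S k + tau k.+1 * enorm (m k.+1) ^+ 2 by rewrite /S big_nat_recr.
have term0 k : 0 <= tau k * enorm (m k) ^+ 2 by rewrite mulr_ge0 ?sqr_ge0// ltW.
have S0 k : 0 <= S k by apply: sumr_ge0.
have S_nd : nondecreasing_seq S.
  by apply/nondecreasing_seqP => k; rewrite SS lerDl.
pose rho k := (Num.sqrt (eps0 + S k))^-1.
have etaE k : eta k = mu k * rho k by rewrite eta_def.
have eS k : 0 < eps0 + S k by rewrite ltr_pwDl.
have rho_gt0 k : 0 < rho k by rewrite invr_gt0 sqrtr_gt0.
have rho_ni : nonincreasing_seq rho.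
  move=> k l kl; rewrite lef_pV2 ?posrE ?sqrtr_gt0// ler_wsqrtr// lerD2l.
  exact: S_nd.
have eta_gt0 k : 0 < eta k by rewrite etaE mulr_gt0.
have [[B SB]|Sdvg] := pselect (exists B, forall k, S k <= B).
  have S_cvg : cvgn S.
    by apply: nondecreasing_is_cvgn => //; exists B => _ [k _ <-].
  have incr : S k.+1 - S k @[k --> \oo] --> (0 : R).
    rewrite -(subrr (limn S)); apply: cvgB => //.
    by rewrite (cvg_shiftS S).
  apply: (@vanishing_momentum_critical _ _ _ _ _ N_gt0 fs_field critical_values beta Mx x m g
    eta idx beta_ge0 beta_lt1 xM eta_gt0 m_def x_def reshuffling g_near (P * rho 0%N)).
    by move=> k; rewrite etaE; apply: ler_pM => //; [exact: ltW|exact: ltW|exact: rho_ni].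
  rewrite -(cvg_shiftS m); apply/cvgrPdist_lt => e e0.
  (* As [tau] is nondecreasing, an increment of [S] is at least [tau 0] times the squared norm of
     the new momentum. *)
  have te : 0 < tau 0%N * e ^+ 2 by rewrite mulr_gt0// exprn_gt0.
  have [K _ hK] : \forall k \near \oo, S k.+1 - S k < tau 0%N * e ^+ 2.
    by apply: (cvgr_lt _ incr).
  exists K => // k /= Kk; rewrite sub0r normrN.
  apply: (le_lt_trans (norm_le_enorm _)).
  rewrite -(@ltr_pXn2r _ 2) ?nnegrE ?sqrtr_ge0 ?(ltW e0)//.
  rewrite -(ltr_pM2l (tau_gt0 0%N)); apply: le_lt_trans (hK k Kk).
  by rewrite SS addrAC subrr add0r ler_wpM2r ?sqr_ge0// tau_nd.
have rho_to0 : rho @ \oo --> (0 : R).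
  apply/cvgrPdist_lt => e e0.
  have [K hK] : exists K, e^-1 ^+ 2 < S K.
    apply: contrapT => h; apply: Sdvg; exists (e^-1 ^+ 2) => k.
    by rewrite leNgt; apply/negP => hk; apply: h; exists k.
  exists K => // k /= Kk; rewrite sub0r normrN (gtr0_norm (rho_gt0 k)).
  rewrite -[ltRHS]invrK /rho ltf_pV2 ?posrE ?sqrtr_gt0 ?invr_gt0//.
  have ei : 0 < e^-1 by rewrite invr_gt0.
  rewrite -(gtr0_norm ei) -sqrtr_sqr ltr_sqrt//.
  apply: (lt_le_trans hK); apply: (@le_trans _ _ (S k)); first exact: S_nd.
  by rewrite lerDr ltW.
have eta_to0 : eta @ \oo --> (0 : R).
  apply/cvgrPdist_lt => e e0.
  have [K _ hK] : \forall k \near \oo, rho k < e / P.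
    by apply: (cvgr_lt _ rho_to0); rewrite divr_gt0.
  exists K => // k Kk; rewrite /= sub0r normrN (gtr0_norm (eta_gt0 k)) etaE.
  apply: (@le_lt_trans _ _ (P * rho k)); first by rewrite ler_wpM2r// ltW.
  by rewrite mulrC -ltr_pdivlMr//; exact: hK.
have Mm0 : 0 <= Mm by apply: le_trans (mM 0%N).
pose Q := P * (n%:R * Mm) ^+ 2.
have Q0 : 0 <= Q by rewrite mulr_ge0 ?sqr_ge0// ltW.
have SQ k : S k <= k%:R * Q.
  elim: k => [|k IH]; first by rewrite /S big_geq// mul0r.
  rewrite SS -natr1 mulrDl mul1r lerD//; apply: ler_pM => //; first exact: ltW.
    exact: sqr_ge0.
  rewrite ler_pXn2r ?nnegrE ?sqrtr_ge0 ?mulr_ge0//.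
  by apply: (le_trans (enorm_le_norm _)); rewrite ler_wpM2l.
(* The crude bound [sqrt u <= 1 + u] and the linear growth of [S] bound the denominator by
   [(1 + eps0 + Q) * k.+1]. *)
have eta_lb k : mu 0%N / (1 + eps0 + Q) / k.+1%:R <= eta k.
  rewrite etaE -mulrA; apply: ler_pM; rewrite ?mu_nd//; first exact: ltW.
    by rewrite mulr_ge0// invr_ge0 !addr_ge0// ltW.
  have sqrt_le (u : R) : 0 <= u -> Num.sqrt u <= 1 + u.
    move=> u0; rewrite -[leRHS]ger0_norm ?addr_ge0// -sqrtr_sqr ler_wsqrtr//.
    have := sqr_ge0 u; rewrite expr2 => ?; rewrite expr2; lra.
  have Q1 : 0 < 1 + eps0 + Q by rewrite ltr_wpDr// addr_gt0.
  rewrite -invfM lef_pV2 ?posrE ?sqrtr_gt0 ?mulr_gt0//.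
  apply: (le_trans (sqrt_le _ (ltW (eS k)))); have := SQ k.
  have := mulr_ge0 (ler0n R k) (ltW eps0_gt0).
  have := ler0n R k; rewrite -[k.+1%:R]natr1; lra.
apply: (@vanishing_steps_critical _ _ _ _ _ N_gt0 fs_field critical_values beta Mx Mg Mm x m g
  eta idx beta_ge0 beta_lt1 xM gM mM eta_gt0 m_def x_def reshuffling g_near
  (2 * (P * rho 0%N)) eta_to0).
  move=> k; under eq_bigr do rewrite !etaE.
  apply: weighted_step_variation => //; first by move=> i; rewrite muP ltW.
  by move=> i; exact: ltW.
apply: epoch_harmonic_dvg eta_lb => //.
by rewrite divr_gt0// ltr_wpDr// addr_gt0.
Qed.
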